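(* Let $B_r$ be a nonnegative invertible selfadjoint operator in a real Hilbert space $\mathcal X_r$, and let $J_r$ be a bounded linear operator in $\mathcal X_r$ with $J_r^*=-J_r$, $J_r^2=-1$. Put $A_r=J_rB_r$. Then: i) A solution $X_r(t)\in C(\mathbb R,\mathcal V_r)$ to $\dot X_r(t)=A_rX_r(t)$, $t\in\mathbb R$, exists and is unique for any initial state $X_r(0)\in\mathcal V_r$, and the energy $\mathcal H_0(X_r)=\frac12\langle B_rX_r,X_r\rangle_r$ is conserved along it. ii) This solution admits the spectral representation $$X_r(t)=\Lambda_r^{-1}\int\big[\cos\omega t\,dE_{rr}(\omega)+\sin\omega t\,dE_{ir}(\omega)\big]\Lambda_rX_r(0),\qquad X_r(0)\in\mathcal V_r,$$ where the Riemann–Stieltjes integral converges in $\mathcal X_r$.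
   Context: ''Invertible'' means having a bounded inverse defined on all of $\mathcal X_r$; thus $\sigma(B_r)\subset[\delta,\infty)$ for some $\delta>0$. $\langle\cdot,\cdot\rangle_r$ is the scalar product of $\mathcal X_r$. $\Lambda_r:=B_r^{1/2}$ and $\mathcal V_r:=D(\Lambda_r)$ with the norm $\Vert X\Vert_{\mathcal V_r}=\Vert\Lambda_rX\Vert_{\mathcal X_r}$; for $X_r\in\mathcal V_r$ the energy is understood as the quadratic form $\frac12\Vert\Lambda_rX_r\Vert^2$. A solution means $X_r(t)\in C(\mathbb R,\mathcal V_r)$ with $A_r^{-1}[X_r(t)-X_r(0)]=\int_0^tX_r(s)\,ds$ for all $t\in\mathbb R$, where $A_r^{-1}=-B_r^{-1}J_r$. Complexifications: on $\mathcal X=\mathcal X_r+i\mathcal X_r$ define $B(X_1+iX_2)=B_rX_1+iB_rX_2$ and $J(X_1+iX_2)=J_rX_1+iJ_rX_2$. Let $\Lambda=B^{1/2}$, which is the complexification of $\Lambda_r$. The operator $H=\Lambda iJ\Lambda$ with domain $D(H)=\{X\in D(\Lambda):J\Lambda X\in D(\Lambda)\}$, i.e. $H=R^{-1}$ with $R=\Lambda^{-1}iJ\Lambda^{-1}$, is selfadjoint in $\mathcal X$; $E(\omega)$ is its spectral resolution. $E_{rr}(\omega)$ and $E_{ir}(\omega)$ denote the real and imaginary components of $E(\omega)|_{\mathcal X_r}$: for $x\in\mathcal X_r$, $E(\omega)x=E_{rr}(\omega)x+iE_{ir}(\omega)x$ with $E_{rr}(\omega)x,E_{ir}(\omega)x\in\mathcal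 X_r$. *)

(* Defs.v *)
From Stdlib Require Import Reals.
From mathcomp Require Import ssreflect seq.
From Coquelicot Require Export Coquelicot.
#[global] Open Scope R_scope.

(** * Real Hilbert spaces and unbounded operators *)

(* A real Hilbert space is a [CompleteNormedModule R_AbsRing] whose norm comes
   from a scalar product. *)
Record inner_product {X : NormedModule R_AbsRing} (ip : X -> X -> R) : Prop := {
  ip_sym : forall x y, ip x y = ip y x;
  ip_plus : forall x y z, ip (plus x y) z = ip x z + ip y z;
  ip_scal : forall (a : R) x y, ip (scal a x) y = a * ip x y;
  ip_norm : forall x, ip x x = norm x ^ 2
}.

(* An unbounded operator is given by its graph: [T x y] means that x is in the
   domain D(T) and that T x = y. *)
Definition operator (X : Type) := X -> X -> Prop.

Definition op_dom {X : Type} (T : operator X) (x : X) : Prop :=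
  exists y, T x y.

Definition op_fun {X : Type} (f : X -> X) : operator X :=
  fun x y => y = f x.

(* D(ST) = {x in D(T) : T x in D(S)}. *)
Definition op_comp {X : Type} (S T : operator X) : operator X :=
  fun x z => exists y, T x y /\ S y z.

Definition op_inv {X : Type} (T : operator X) : operator X :=
  fun y x => T x y.

Definition op_adjoint {X : NormedModule R_AbsRing} (ip : X -> X -> R)
  (T : operator X) : operator X :=
  fun y z => forall x w, T x w -> ip w y = ip x z.

Definition densely_defined {X : NormedModule R_AbsRing} (T : operator X) : Prop :=
  forall (x : X) (eps : posreal), exists y, op_dom T y /\ norm (minus y x) < eps.

(* Linearity and single-valuedness of T follow, since the adjoint of a densely
   defined T is a linear single-valued operator. *)
Definition selfadjoint {X : NormedModule R_AbsRing} (ip : X -> X -> R)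
  (T : operator X) : Prop :=
  densely_defined T /\ forall x y, T x y <-> op_adjoint ip T x y.

Definition nonnegative {X : NormedModule R_AbsRing} (ip : X -> X -> R)
  (T : operator X) : Prop :=
  forall x y, T x y -> 0 <= ip y x.

Definition invertible {X : NormedModule R_AbsRing} (T : operator X) : Prop :=
  exists S : X -> X, is_linear S /\ forall y x, op_inv T y x <-> op_fun S y x.

(* L = B^{1/2}: the nonnegative selfadjoint square root. *)
Definition is_sqrt {X : NormedModule R_AbsRing} (ip : X -> X -> R)
  (L B : operator X) : Prop :=
  selfadjoint ip L /\ nonnegative ip L /\
  forall x y, B x y <-> op_comp L L x y.

(** * Riemann-Stieltjes integrals *)

(* The analogue of [Riemann_sum] with increments of an integrator g. *)
Definition Stieltjes_sum {V : NormedModule R_AbsRing} (f : R -> R) (g : R -> V)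
  (ptd : SF_seq) : V :=
  foldr plus zero
    (pairmap (fun x y : R * R => scal (f (snd y)) (minus (g (fst y)) (g (fst x))))
       (SF_h ptd, 0) (SF_t ptd)).

(* The integral of f dg over [a, b], for a <= b, is I (mesh tending to 0). *)
Definition is_RSInt {V : NormedModule R_AbsRing} (f : R -> R) (g : R -> V)
  (a b : R) (I : V) : Prop :=
  filterlim (Stieltjes_sum f g) (Riemann_fine a b) (locally I).

(* The integral of f dg over the real line, as the limit of the integrals over
   [a, b] when a -> -oo and b -> +oo; same pattern as [is_RInt_gen]. *)
Definition is_RSInt_line {V : NormedModule R_AbsRing} (f : R -> R) (g : R -> V)
  (I : V) : Prop :=
  filterlimi (fun ab : R * R => is_RSInt f g (fst ab) (snd ab))
    (filter_prod (Rbar_locally m_infty) (Rbar_locally p_infty)) (locally I).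

(** * Complexification and spectral resolutions *)

(* The pair (x1, x2) stands for x1 + i x2.  The product norm of Coquelicot is
   sqrt (|x1|^2 + |x2|^2), that is, the Hilbert norm of the complexification. *)
Definition cplx (X : NormedModule R_AbsRing) : NormedModule R_AbsRing :=
  prod_NormedModule R_AbsRing X X.

Definition cplx_scal {X : NormedModule R_AbsRing} (c : C) (z : cplx X) : cplx X :=
  (minus (scal (Re c) (fst z)) (scal (Im c) (snd z)),
   plus (scal (Re c) (snd z)) (scal (Im c) (fst z))).

(* Linear in the first argument, antilinear in the second one. *)
Definition cplx_ip {X : NormedModule R_AbsRing} (ip : X -> X -> R)
  (z w : cplx X) : C :=
  (ip (fst z) (fst w) + ip (snd z) (snd w),
   ip (snd z) (fst w) - ip (fst z) (snd w)).

Definition cplx_op {X : NormedModule R_AbsRing} (T : operator X) :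
  operator (cplx X) :=
  fun z w => T (fst z) (fst w) /\ T (snd z) (snd w).

(* H = L iJ L, for the complexifications of L and J. *)
Definition hamiltonian {X : NormedModule R_AbsRing} (L : operator X)
  (J : X -> X) : operator (cplx X) :=
  op_comp (cplx_op L)
    (op_comp (op_fun (fun z : cplx X => cplx_scal Ci (J (fst z), J (snd z))))
       (cplx_op L)).

Record orthogonal_projection {X : NormedModule R_AbsRing} (ip : X -> X -> R)
  (P : cplx X -> cplx X) : Prop := {
  proj_linear : forall (c : C) (z w : cplx X),
    P (plus (cplx_scal c z) w) = plus (cplx_scal c (P z)) (P w);
  proj_idem : forall z, P (P z) = P z;
  proj_sym : forall z w, cplx_ip ip (P z) w = cplx_ip ip z (P w)
}.

(* E is a right-continuous resolution of the identity and H is the integral of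
   w dE(w), with domain the set of z for which w^2 is integrable with respect
   to d|E(w)z|^2. *)
Record spectral_resolution {X : NormedModule R_AbsRing} (ip : X -> X -> R)
  (H : operator (cplx X)) (E : R -> cplx X -> cplx X) : Prop := {
  sr_proj : forall w, orthogonal_projection ip (E w);
  sr_mono : forall v w z, E v (E w z) = E (Rmin v w) z;
  sr_right : forall w z, filterlim (fun s => E s z) (at_right w) (locally (E w z));
  sr_minfty : forall z,
    filterlim (fun s => E s z) (Rbar_locally m_infty) (locally (zero : cplx X));
  sr_pinfty : forall z,
    filterlim (fun s => E s z) (Rbar_locally p_infty) (locally z);
  sr_dom : forall z, op_dom H z <->
    exists m : R, is_RSInt_line (fun w => w ^ 2) (fun w => norm (E w z) ^ 2) m;
  sr_val : forall z y, H z y -> is_RSInt_line (fun w => w) (fun w => E w z) y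
}.

(* The real and imaginary components of the restriction of E(w) to X. *)
Definition E_rr {X : NormedModule R_AbsRing} (E : R -> cplx X -> cplx X)
  (w : R) (x : X) : X := fst (E w (x, zero)).

Definition E_ir {X : NormedModule R_AbsRing} (E : R -> cplx X -> cplx X)
  (w : R) (x : X) : X := snd (E w (x, zero)).

(** * Solutions *)

(* X is in C(R, V) where V = D(L) carries the norm |L x|. *)
Definition continuous_in_dom {X : NormedModule R_AbsRing} (L : operator X)
  (x : R -> X) : Prop :=
  (forall t, op_dom L (x t)) /\
  forall (t : R) (eps : posreal),
    locally t (fun s => exists u, L (minus (x s) (x t)) u /\ norm u < eps).

Definition is_solution {X : NormedModule R_AbsRing} (L A : operator X)
  (x : R -> X) : Prop :=
  continuous_in_dom L x /\
  forall t, exists I, is_RInt x 0 t I /\ op_inv A (minus (x t) (x 0)) I.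

(* The value h of the quadratic form |L x|^2 / 2 at x in D(L). *)
Definition energy {X : NormedModule R_AbsRing} (L : operator X) (x : X) (h : R) :
  Prop :=
  exists u, L x u /\ h = / 2 * norm u ^ 2.

(* A^{-1} = - B^{-1} J for A = J B. *)
Lemma op_inv_JB {X : NormedModule R_AbsRing} (B : operator X) (J : X -> X)
  (hJ : is_linear J) (hJ2 : forall x, J (J x) = opp x) (z w : X) :
  op_inv (op_comp (op_fun J) B) z w <->
  op_comp (op_inv B) (op_fun (fun x => opp (J x))) z w.
Proof.
split; rewrite /op_inv /op_comp /op_fun.
- by move=> [u [Hu ->]]; exists u; split=> //; rewrite hJ2 opp_opp.
- move=> [u [-> Hu]]; exists (opp (J z)); split=> //.
  rewrite -scal_opp_one (linear_scal _ hJ) scal_opp_one hJ2 opp_opp //.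
Qed.

(* Main.v *)
Require Import Defs.
From Stdlib Require Import Reals Lra Lia ClassicalEpsilon.
From mathcomp Require Import ssreflect seq.
From Coquelicot Require Import Coquelicot.

(** Put [S = L^-1] (bounded, symmetric) and [G = - S J S], the bounded, skew,
    injective inverse of [L J L].  With [u = L x] the solutions [x] correspond to
    the continuous [u] with [(G u)' = u].  Two such [u] with the same initial
    value agree because [|G u|] is constant, and [|u|] is constant because
    [|G u (t + h) - G u t|] does not depend on [t].  Existence: the resolvents
    [R_h = (1 - h G^-1)^-1] are contractions for all real [h], and the implicit
    Euler scheme [R_(t/n)^n] converges on the range of [G^2], which is dense.

    For the spectral representation, let [Q = E b - E a].  Since
    [H = i G^-1] is symmetric, [E] commutes with [G]; on the range of [Q] the
    operator [H] is within [b - a] of any [xi] in [[a, b]], hence the unitary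
    group [exp (- i t H)] is there within [|t| (b - a)] of [exp (- i t xi)].
    The errors on the pieces of a partition are orthogonal, so the
    Riemann-Stieltjes sums of [cos (w t)] and [sin (w t)] converge to the even
    and odd parts of the group. *)

(** * Inner product spaces and derivatives *)

(** The generator [G^-1] is unbounded and [u = L x] is merely continuous, so a weak solution can be
    differentiated only after an application of [G]. Bounds on the generator are replaced by
    [norm_growth], which asks only for control of [<f', f>]: a term of [f'] orthogonal to [f] drops
    out, however large it is. The convergence of the Euler scheme and the comparison with
    [exp (- i t xi)] both rest on this. No functional calculus is at hand: [E] is known only through
    the integral of [w dE(w)] on [D(H)], so its commutation with [G] has to be extracted from
    Riemann-Stieltjes sums. The complexification is treated as a real Hilbert space, with the real
    part of its scalar product and a skew map [im], so the results on real spaces apply to it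
    verbatim. Since [(iJ)^2 = 1], one has [H^-1 = S iJ S = - i G] and [u t = exp (- i t H) (u 0)].
    The flow preserves real vectors, so [cos (t H) (u 0)] is real and [sin (t H) (u 0)] purely
    imaginary: hence [cos] goes with [E_rr] and [sin] with [E_ir]. *)

Section InnerProduct.

Context {X : NormedModule R_AbsRing} {ip : X -> X -> R}.
Context (hip : inner_product ip).

Lemma ip_plus_r x y z : ip x (plus y z) = ip x y + ip x z.
Proof. by rewrite ip_sym // ip_plus // (ip_sym ip hip y) (ip_sym ip hip z). Qed.

Lemma ip_scal_r a x y : ip x (scal a y) = a * ip x y.
Proof. by rewrite ip_sym // ip_scal // (ip_sym ip hip y). Qed.

Lemma ip_opp_l x y : ip (opp x) y = - ip x y.
Proof. rewrite -scal_opp_one ip_scal // /opp /one /=; ring. Qed.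

Lemma ip_opp_r x y : ip x (opp y) = - ip x y.
Proof. by rewrite ip_sym // ip_opp_l (ip_sym ip hip y). Qed.

Lemma ip_zero_l y : ip zero y = 0.
Proof. rewrite -(scal_zero_l (zero : X)) ip_scal // /zero /=; ring. Qed.

Lemma ip_zero_r y : ip y zero = 0.
Proof. by rewrite ip_sym // ip_zero_l. Qed.

Lemma ip_minus_l x y z : ip (minus x y) z = ip x z - ip y z.
Proof. by rewrite /minus ip_plus // ip_opp_l. Qed.

Lemma ip_minus_r x y z : ip z (minus x y) = ip z x - ip z y.
Proof. by rewrite /minus ip_plus_r ip_opp_r. Qed.

Definition ipE := (ip_plus ip hip, ip_plus_r, ip_scal ip hip, ip_scal_r,
  ip_opp_l, ip_opp_r, ip_zero_l, ip_zero_r).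

Lemma ip_ext x y : (forall z, ip x z = ip y z) -> x = y.
Proof.
move=> H; apply: (plus_reg_r (opp y)); rewrite plus_opp_r.
apply: norm_eq_zero; apply: Rsqr_0_uniq.
have := ip_norm ip hip (plus x (opp y)).
rewrite ip_plus // ip_opp_l H /Rsqr; set n := norm _ => E; nra.
Qed.

Lemma ip_nonneg x : 0 <= ip x x.
Proof. by rewrite ip_norm //; apply: pow2_ge_0. Qed.

Lemma norm_sqrt_ip x : norm x = sqrt (ip x x).
Proof. by rewrite ip_norm // sqrt_pow2 //; apply: norm_ge_0. Qed.

Lemma norm_le_of_sq x c : 0 <= c -> ip x x <= c ^ 2 -> norm x <= c.
Proof.
move=> hc; rewrite ip_norm // => H.
by apply: (Rsqr_incr_0_var _ _ _ hc); rewrite /Rsqr; lra.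
Qed.

Lemma cauchy_schwarz x y : Rabs (ip x y) <= norm x * norm y.
Proof.
have key : ip x y ^ 2 <= norm x ^ 2 * norm y ^ 2.
  have H t := ip_nonneg (plus (scal t x) y).
  have H1 t : 0 <= t ^ 2 * norm x ^ 2 + 2 * t * ip x y + norm y ^ 2.
    by have := H t; rewrite !ipE (ip_sym ip hip y x) !ip_norm //; lra.
  case: (Req_dec (norm x ^ 2) 0) => hx; last first.
    have hx0 : 0 < norm x ^ 2 by have := pow2_ge_0 (norm x); lra.
    have := H1 (- ip x y / norm x ^ 2).
    have -> : (- ip x y / norm x ^ 2) ^ 2 * norm x ^ 2 +
      2 * (- ip x y / norm x ^ 2) * ip x y + norm y ^ 2 =
      (norm x ^ 2 * norm y ^ 2 - ip x y ^ 2) * / norm x ^ 2.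
      by field => h; rewrite h in hx0; lra.
    move=> H2; apply: Rnot_lt_le => H3.
    have h4 : 0 < ip x y ^ 2 - norm x ^ 2 * norm y ^ 2 by lra.
    have h5 := Rmult_lt_0_compat _ _ h4 (Rinv_0_lt_compat _ hx0); lra.
  have -> : x = zero.
    by apply: norm_eq_zero; apply: Rsqr_0_uniq; rewrite /Rsqr; lra.
  rewrite ip_zero_l norm_zero; lra.
apply: Rsqr_incr_0_var; last by apply: Rmult_le_pos; apply: norm_ge_0.
by rewrite -Rsqr_abs /Rsqr; lra.
Qed.

(** Cauchy-Schwarz applied to [|P x|^2 = <P x, x>]. It serves both for [E w] and for the increments
    of [E]. *)
Lemma projection_norm (P : X -> X) (x : X) :
  (forall y z, ip (P y) z = ip y (P z)) -> (forall y, P (P y) = P y) ->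
  norm (P x) <= norm x.
Proof.
move=> hsym hidem.
have h : norm (P x) ^ 2 = ip (P x) x by rewrite -(ip_norm ip hip) -hsym hidem.
have := cauchy_schwarz (P x) x; have := Rle_abs (ip (P x) x); rewrite -h => h1 h2.
case: (Req_dec (norm (P x)) 0) => [->|h3]; first exact: norm_ge_0.
have h4 : 0 < norm (P x) by have := norm_ge_0 (P x); lra.
by apply: (Rmult_le_reg_l (norm (P x))) => //; lra.
Qed.

Lemma norm_minus_sym (x y : X) : norm (minus x y) = norm (minus y x).
Proof. by rewrite -norm_opp opp_minus. Qed.

Lemma norm_plus_le (x y : X) a b :
  norm x <= a -> norm y <= b -> norm (plus x y) <= a + b.
Proof. by move=> hx hy; have := norm_triangle x y; lra. Qed.

Lemma norm_plus_lt (x y : X) a b :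
  norm x < a -> norm y < b -> norm (plus x y) < a + b.
Proof. by move=> hx hy; have := norm_triangle x y; lra. Qed.

Lemma norm_minus_triangle (y x z : X) :
  norm (minus x z) <= norm (minus x y) + norm (minus y z).
Proof. by rewrite (minus_trans y); apply: norm_triangle. Qed.

Lemma norm_scal_R (a : R) (x : X) : norm (scal a x) = Rabs a * norm x.
Proof.
rewrite !norm_sqrt_ip !ipE.
have -> : a * (a * ip x x) = Rsqr a * ip x x by rewrite /Rsqr; ring.
rewrite sqrt_mult ?sqrt_Rsqr_abs //; [apply: Rle_0_sqr|apply: ip_nonneg].
Qed.

End InnerProduct.

(* Proves a vector identity by pairing both sides with an arbitrary vector. *)
Ltac vec hip :=
  apply: (ip_ext hip); let z := fresh "z" in intro z;
  rewrite /minus !(ipE hip); try ring.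

(** * Vector-valued derivatives and growth estimates *)

Section Derivatives.

Context {X : NormedModule R_AbsRing} {ip : X -> X -> R}.
Context (hip : inner_product ip).

Lemma is_derive_eps (f : R -> X) (t : R) (l : X) :
  is_derive f t l <-> forall eps : R, 0 < eps -> exists delta : posreal,
    forall s, Rabs (s - t) < delta ->
    norm (minus (minus (f s) (f t)) (scal (s - t) l)) <= eps * Rabs (s - t).
Proof.
split.
- move=> [_ H] eps he.
  have [delta Hd] := H t (fun P HP => HP) (mkposreal eps he).
  exists delta => s hs; exact: (Hd s hs).
- move=> H; split; first by apply: is_linear_scal_l.
  move=> x hx eps.
  have <- : t = x by apply: is_filter_lim_locally_unique.
  have [delta Hd] := H eps (cond_pos eps).
  exists delta => s hs; exact: (Hd s hs).
Qed.

Lemma is_derive_quadratic (f : R -> X) (t C : R) (l : X) :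
  (forall s, norm (minus (minus (f s) (f t)) (scal (s - t) l))
     <= C * (s - t) ^ 2) -> is_derive f t l.
Proof.
move=> H; apply/is_derive_eps => eps he.
have hC : 0 < Rabs C + 1 by have := Rabs_pos C; lra.
have hd : 0 < eps / (Rabs C + 1) by apply: Rdiv_lt_0_compat.
exists (mkposreal _ hd) => s /= hs.
apply: Rle_trans (H s) _.
rewrite -(pow2_abs (s - t)) /= Rmult_1_r -Rmult_assoc.
apply: Rmult_le_compat_r; first exact: Rabs_pos.
apply: Rle_trans (_ : (Rabs C + 1) * Rabs (s - t) <= _).
  apply: Rmult_le_compat_r; first exact: Rabs_pos.
  have := Rle_abs C; lra.
have : (Rabs C + 1) * Rabs (s - t) < (Rabs C + 1) * (eps / (Rabs C + 1)).
  by apply: Rmult_lt_compat_l.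
have -> : (Rabs C + 1) * (eps / (Rabs C + 1)) = eps by field; lra.
lra.
Qed.

Lemma is_derive_linear {Y : NormedModule R_AbsRing} (l : X -> Y) (f : R -> X)
  (t : R) (df : X) :
  is_linear l -> is_derive f t df -> is_derive (fun s => l (f s)) t (l df).
Proof.
move=> hl hf.
have H := filterdiff_comp' f l t _ l hf (filterdiff_linear l hl).
apply: filterdiff_ext_lin H _ => y; exact: linear_scal.
Qed.

(** Write [|f s|^2 = 2 <f s, f t> + |f s - f t|^2 - |f t|^2]. The first term is a bounded linear
    functional of [f s]; the second is of order [(s - t)^2] and has derivative zero at [t]. *)
Lemma is_derive_norm_sq (f : R -> X) (t : R) (df : X) :
  is_derive f t df ->
  is_derive (fun s => norm (f s) ^ 2) t (2 * ip df (f t)).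
Proof.
move=> hf.
have hl : is_linear (fun y => 2 * ip y (f t)).
  split.
  - by move=> x y; rewrite ip_plus // /plus /=; ring.
  - by move=> k x; rewrite ip_scal // /scal /= /mult /=; ring.
  - exists (2 * norm (f t) + 1); split; first by have := norm_ge_0 (f t); lra.
    move=> x; have := cauchy_schwarz hip x (f t).
    have := norm_ge_0 x.
    change (norm (2 * ip x (f t))) with (Rabs (2 * ip x (f t))).
    rewrite Rabs_mult (Rabs_right 2); lra.
have h1 := is_derive_linear _ _ _ _ hl hf.
have h2 : is_derive (fun s => norm (minus (f s) (f t)) ^ 2) t 0.
  have hc : is_derive (fun s => minus (f s) (f t)) t df.
    rewrite -(minus_zero_r df).
    by apply: is_derive_minus => //; apply: is_derive_const.
  apply/is_derive_Reals => eps he.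
  have hM : 0 < norm df + 1 by have := norm_ge_0 df; lra.
  have he' : 0 < Rmin 1 (eps / (2 * (norm df + 1) ^ 2)).
    apply: Rmin_pos; first lra.
    by apply: Rdiv_lt_0_compat => //; nra.
  have [d Hd] := proj1 (is_derive_eps _ _ _) hf 1 Rlt_0_1.
  exists (mkposreal _ (Rmin_pos _ _ (cond_pos d) he')) => h h0 /= hh.
  have hhd : Rabs h < d by apply: Rlt_le_trans hh _; apply: Rmin_l.
  have hhe : Rabs h < eps / (2 * (norm df + 1) ^ 2).
    apply: Rlt_le_trans hh _; apply: Rle_trans (Rmin_r _ _) _; exact: Rmin_r.
  rewrite minus_eq_zero norm_zero.
  have hb : norm (minus (f (t + h)) (f t)) <= (norm df + 1) * Rabs h.
    have := Hd (t + h); have -> : t + h - t = h by ring.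
    move=> /(_ hhd) H.
    have -> : minus (f (t + h)) (f t) =
      plus (minus (minus (f (t + h)) (f t)) (scal h df)) (scal h df).
      by vec hip.
    apply: Rle_trans (norm_triangle _ _) _.
    rewrite (norm_scal_R hip); lra.
  have hb0 := norm_ge_0 (minus (f (t + h)) (f t)).
  have ha : 0 < Rabs h by apply: Rabs_pos_lt.
  have -> : (norm (minus (f (t + h)) (f t)) ^ 2 - 0 ^ 2) / h - 0 =
    norm (minus (f (t + h)) (f t)) ^ 2 * / h by field.
  rewrite Rabs_mult Rabs_inv (Rabs_right (_ ^ 2)); last by nra.
  apply: (Rmult_lt_reg_r (Rabs h)) => //.
  rewrite Rmult_assoc Rinv_l ?Rmult_1_r; last lra.
  apply: Rle_lt_trans (_ : ((norm df + 1) * Rabs h) ^ 2 < _).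
    by apply: pow_incr.
  have hM2 : 0 < (norm df + 1) ^ 2 by nra.
  have : (norm df + 1) ^ 2 * Rabs h < (norm df + 1) ^ 2 * (eps / (2 * (norm df + 1) ^
    2)).
    by apply: Rmult_lt_compat_l.
  have -> : (norm df + 1) ^ 2 * (eps / (2 * (norm df + 1) ^ 2)) = eps / 2 by field; lra.
  nra.
have h3 := is_derive_minus _ _ _ _ _ (is_derive_plus _ _ _ _ _ h1 h2)
  (is_derive_const (norm (f t) ^ 2) t).
have <- : minus (plus (2 * ip df (f t)) 0) zero = 2 * ip df (f t).
  by rewrite /minus /plus /opp /zero /=; ring.
apply: is_derive_ext h3 => s.
change (2 * ip (f s) (f t) + norm (minus (f s) (f t)) ^ 2 + - norm (f t) ^ 2
  = norm (f s) ^ 2).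
rewrite -!(ip_norm ip hip) /minus !(ipE hip) (ip_sym ip hip (f t)); ring.
Qed.

(* The derivative of [sqrt (|f|^2 + eta^2)] is at most [c] for all [eta > 0]. *)
Lemma norm_growth (f df : R -> X) (t0 t c : R) :
  0 <= c -> f t0 = zero ->
  (forall s, Rmin t0 t <= s <= Rmax t0 t ->
     is_derive f s (df s) /\ Rabs (ip (df s) (f s)) <= c * norm (f s)) ->
  norm (f t) <= c * Rabs (t - t0).
Proof.
move=> hc h0 H; apply: le_epsilon => eta heta.
have he2 : 0 < eta ^ 2 by nra.
(* The norm may fail to be differentiable where [f] vanishes, as it does at [t0]. The root of [q] is
   differentiable, dominates [norm (f s)] and equals [eta] at [t0], which is the slack granted by
   [le_epsilon]. *)
pose q s := norm (f s) ^ 2 + eta ^ 2.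
have hq s : 0 < q s by rewrite /q; have := pow2_ge_0 (norm (f s)); lra.
have hD s : Rmin t0 t <= s <= Rmax t0 t ->
  is_derive (fun s => sqrt (q s)) s (ip (df s) (f s) / sqrt (q s)).
  move=> /H [hd _].
  have hs := sqrt_lt_R0 _ (hq s).
  have -> : ip (df s) (f s) / sqrt (q s) = (2 * ip (df s) (f s) + 0) / (2 * sqrt (q s)).
    field; lra.
  apply: is_derive_sqrt => //.
  by apply: (is_derive_plus (fun s => norm (f s) ^ 2));
    [apply: is_derive_norm_sq|apply: is_derive_const].
have [||s [hs E]] := MVT_gen (fun s => sqrt (q s)) t0 t (fun s => ip (df s)
  (f s) / sqrt (q s)).
- by move=> s hs; apply: hD; lra.
- move=> s hs; apply: derivable_continuous_pt.
  exists (ip (df s) (f s) / sqrt (q s)); apply/is_derive_Reals; exact: hD.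
have hsq : sqrt (q t0) = eta.
  rewrite /q h0 norm_zero; have -> : 0 ^ 2 + eta ^ 2 = eta ^ 2 by ring.
  by rewrite sqrt_pow2 //; lra.
have h1 : norm (f t) <= sqrt (q t).
  rewrite -(sqrt_pow2 (norm (f t))); last exact: norm_ge_0.
  apply: sqrt_le_1_alt; rewrite /q; lra.
have h2 : Rabs (ip (df s) (f s) / sqrt (q s)) <= c.
  have hs0 := sqrt_lt_R0 _ (hq s).
  rewrite /Rdiv Rabs_mult Rabs_inv (Rabs_right (sqrt _)); last lra.
  apply: (Rmult_le_reg_r (sqrt (q s))) => //.
  rewrite Rmult_assoc Rinv_l ?Rmult_1_r; last lra.
  have [_ h3] := H s hs; apply: Rle_trans h3 _.
  apply: Rmult_le_compat_l => //.
  rewrite -(sqrt_pow2 (norm (f s))); last exact: norm_ge_0.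
  apply: sqrt_le_1_alt; rewrite /q; lra.
have h3 : Rabs (sqrt (q t) - sqrt (q t0)) <= c * Rabs (t - t0).
  by rewrite E Rabs_mult; apply: Rmult_le_compat_r => //; apply: Rabs_pos.
have := Rle_abs (sqrt (q t) - sqrt (q t0)); lra.
Qed.

Lemma norm_constant (f df : R -> X) :
  (forall s, is_derive f s (df s)) -> (forall s, ip (df s) (f s) = 0) ->
  forall t, norm (f t) = norm (f 0).
Proof.
move=> hf h0 t.
have hD s : is_derive (fun s => norm (f s) ^ 2) s 0.
  by have := is_derive_norm_sq _ _ _ (hf s); rewrite h0 Rmult_0_r.
have [||s [_ E]] := MVT_gen (fun s => norm (f s) ^ 2) 0 t (fun _ => 0).
- by move=> s _; apply: hD.
- move=> s _; apply: derivable_continuous_pt.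
  by exists 0; apply/is_derive_Reals; exact: hD.
have h1 : norm (f t) ^ 2 = norm (f 0) ^ 2 by lra.
by rewrite -(sqrt_pow2 (norm (f t)) (norm_ge_0 _)) h1 sqrt_pow2 //; apply: norm_ge_0.
Qed.

(** The function [f n r - f n t - (r - t) G t] has derivative [g n r - G t], small near [t]
    uniformly in large [n]. So [norm_growth] bounds it by [eps |s - t|], and this bound survives the
    pointwise limit in [n]. *)
Lemma is_derive_limit (f g : nat -> R -> X) (F G : R -> X) (t : R) :
  (forall n s, is_derive (f n) s (g n s)) ->
  (forall s eps, 0 < eps ->
     exists N, forall n, (N <= n)%nat -> norm (minus (f n s) (F s)) <= eps) ->
  (forall eps, 0 < eps -> exists (delta : posreal) (N : nat),
     forall n s, (N <= n)%nat -> Rabs (s - t) < delta ->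
     norm (minus (g n s) (G t)) <= eps) ->
  is_derive F t (G t).
Proof.
move=> hfg hF hG; apply/is_derive_eps => eps he.
have [delta [N HN]] := hG eps he.
exists delta => s hs; apply: le_epsilon => eta heta.
have heta2 : 0 < eta / 2 by lra.
have [N1 H1] := hF s _ heta2.
have [N2 H2] := hF t _ heta2.
pose n := (N + N1 + N2)%nat.
have h1 := H1 n ltac:(rewrite /n; lia).
have h2 := H2 n ltac:(rewrite /n; lia).
pose phi r : X := minus (minus (f n r) (f n t)) (scal (r - t) (G t)).
have h3 : norm (phi s) <= eps * Rabs (s - t).
  apply: (norm_growth phi (fun r => minus (g n r) (G t))) => //; first lra.
    rewrite /phi; vec hip.
  move=> r hr; split.
    have -> : minus (g n r) (G t) = minus (minus (g n r) zero) (scal one (G t)).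
      by rewrite scal_one minus_zero_r.
    apply: is_derive_minus.
      by apply: is_derive_minus => //; apply: is_derive_const.
    apply: (is_derive_scal_l (fun r => r - t)).
    have -> : (one : R) = 1 - 0 by rewrite /one /=; ring.
    by apply: is_derive_minus; [apply: is_derive_id|apply: is_derive_const].
  apply: Rle_trans (cauchy_schwarz hip _ _) _.
  apply: Rmult_le_compat_r; first exact: norm_ge_0.
  apply: HN; first by rewrite /n; lia.
  apply: Rle_lt_trans hs.
  move: hr; rewrite /Rmin /Rmax; case: Rle_dec => h; split_Rabs; lra.
have -> : minus (minus (F s) (F t)) (scal (s - t) (G t)) =
  plus (phi s) (plus (minus (f n t) (F t)) (minus (F s) (f n s))).
  rewrite /phi; vec hip.
have -> : eps * Rabs (s - t) + eta = eps * Rabs (s - t) + (eta / 2 + eta / 2).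
  by field.
apply: norm_plus_le => //; apply: norm_plus_le => //.
by rewrite norm_minus_sym.
Qed.

End Derivatives.

(** * Weak solutions *)

Section Completeness.

Lemma continuous_eps {X : NormedModule R_AbsRing} (u : R -> X) (t : R) :
  continuous u t <-> forall eps : R, 0 < eps -> exists delta : posreal,
    forall s, Rabs (s - t) < delta -> norm (minus (u s) (u t)) < eps.
Proof.
split.
- move=> H eps he.
  have [delta Hd] := proj1 (filterlim_locally_ball_norm u (u t)) H (mkposreal eps he).
  exists delta => s hs; exact: (Hd s hs).
- move=> H; apply/filterlim_locally_ball_norm => eps.
  have [delta Hd] := H eps (cond_pos eps).
  exists delta => s hs; exact: (Hd s hs).
Qed.

Lemma inv_succ_lt (C eps : R) : 0 < eps ->
  exists N, forall n, (N <= n)%nat -> C / INR (S n) < eps.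
Proof.
move=> he; have [N HN] := INR_unbounded (Rabs C / eps); exists N => n hn.
have hn1 : 0 < INR (S n) by apply: lt_0_INR; lia.
have hN : INR N <= INR (S n) by apply: le_INR; lia.
apply: (Rmult_lt_reg_r (INR (S n))) => //.
have -> : C / INR (S n) * INR (S n) = C by field; lra.
have : Rabs C / eps * eps < INR (S n) * eps by apply: Rmult_lt_compat_r; lra.
have -> : Rabs C / eps * eps = Rabs C by field; lra.
have := Rle_abs C; lra.
Qed.

Context {X : CompleteNormedModule R_AbsRing}.

Lemma cauchy_sequence_limit (u : nat -> X) :
  (forall eps, 0 < eps -> exists N, forall n m, (N <= n)%nat -> (N <= m)%nat ->
     norm (minus (u n) (u m)) <= eps) ->
  exists l, forall eps, 0 < eps -> exists N, forall n, (N <= n)%nat ->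
     norm (minus (u n) l) <= eps.
Proof.
move=> H.
have [|l hl] := proj1 (filterlim_locally_cauchy (U := X) (F := eventually) u).
  move=> eps; have he : 0 < eps / 2 by have := cond_pos eps; lra.
  have [N HN] := H _ he; exists (fun n => (N <= n)%nat).
  split; first by exists N.
  move=> n m hn hm; apply: norm_compat1.
  by apply: Rle_lt_trans (HN m n hm hn) _; have := cond_pos eps; lra.
exists l => eps he.
have [N HN] := proj1 (filterlim_locally_ball_norm u l) hl (mkposreal eps he).
by exists N => n hn; apply: Rlt_le; apply: (HN n hn).
Qed.

Lemma contraction_fixed_point (F : X -> X) (q : R) :
  0 <= q < 1 ->
  (forall x y, norm (minus (F x) (F y)) <= q * norm (minus x y)) ->
  exists x, F x = x.
Proof.
move=> hq hF; pose u (n : nat) : X := Nat.iter n F zero.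
pose d := norm (minus (u 1%nat) (u 0%nat)).
have hd : 0 <= d by apply: norm_ge_0.
have step n : norm (minus (u (S n)) (u n)) <= q ^ n * d.
  elim: n => [|n IH]; first by rewrite /d /=; lra.
  apply: Rle_trans (hF _ _) _; rewrite /= Rmult_assoc.
  by apply: Rmult_le_compat_l => //; lra.
have far n k : norm (minus (u (n + k)%nat) (u n)) <= q ^ n * (d / (1 - q)).
  have hqn : 0 <= q ^ n by apply: pow_le; lra.
  (* The exact partial sum of the geometric series is kept so that the induction on [k] closes; only
     afterwards is [1 - q ^ k] bounded by one. *)
  have hk : norm (minus (u (n + k)%nat) (u n)) <= q ^ n * ((1 - q ^ k) * (d / (1 - q))).
    elim: k => [|k IH].
      by rewrite Nat.add_0_r minus_eq_zero norm_zero /=; lra.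
    rewrite Nat.add_succ_r.
    apply: Rle_trans (norm_minus_triangle (u (n + k)%nat) _ _) _.
    apply: Rle_trans (Rplus_le_compat _ _ _ _ (step _) IH) _.
    by rewrite pow_add /=; right; field; lra.
  apply: Rle_trans hk _; apply: Rmult_le_compat_l => //.
  have hd1 : 0 <= d / (1 - q) by apply: Rdiv_le_0_compat; lra.
  have : 0 <= q ^ k by apply: pow_le; lra.
  nra.
have [l hl] : exists l, forall eps, 0 < eps -> exists N, forall n, (N <= n)%nat ->
     norm (minus (u n) l) <= eps.
  apply: cauchy_sequence_limit => eps he.
  have hc : 0 < d / (1 - q) + 1.
    have : 0 <= d / (1 - q) by apply: Rdiv_le_0_compat; lra.
    lra.
  have [N HN] := pow_lt_1_zero q ltac:(rewrite Rabs_right; lra)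
    (eps / 2 / (d / (1 - q) + 1)) ltac:(apply: Rdiv_lt_0_compat; lra).
  exists N => n m hn hm.
  have hN : q ^ N * (d / (1 - q)) <= eps / 2.
    have := HN N (le_n N); rewrite Rabs_right; last by apply: Rle_ge; apply: pow_le;
      lra.
    move=> h; have h0 : 0 <= q ^ N by apply: pow_le; lra.
    have : q ^ N * (d / (1 - q) + 1) <= eps / 2 / (d / (1 - q) + 1) * (d / (1 - q) + 1).
      by apply: Rmult_le_compat_r; lra.
    by have -> : eps / 2 / (d / (1 - q) + 1) * (d / (1 - q) + 1) = eps / 2; [field;
      lra|lra].
  have -> : n = (N + (n - N))%nat by lia.
  have -> : m = (N + (m - N))%nat by lia.
  apply: Rle_trans (norm_minus_triangle (u N) _ _) _.
  have -> : eps = eps / 2 + eps / 2 by field.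
  apply: Rplus_le_compat; last rewrite norm_minus_sym;
    exact: Rle_trans (far _ _) hN.
exists l; apply: (plus_reg_r (opp l)); rewrite plus_opp_r; apply: norm_eq_zero.
apply: Rle_antisym; last exact: norm_ge_0.
apply: le_epsilon => eps he.
have [N HN] := hl (eps / 2) ltac:(lra).
rewrite Rplus_0_l.
apply: Rle_trans (norm_minus_triangle (F (u N)) _ _) _.
have h1 := HN (S N) ltac:(lia); rewrite /u /= -/(u N) in h1.
have h2 := HN N ltac:(lia).
have h3 : norm (minus (F l) (F (u N))) <= eps / 2.
  apply: Rle_trans (hF _ _) _; rewrite norm_minus_sym; apply: Rle_trans h2.
  rewrite -[X in _ <= X]Rmult_1_l.
  by apply: Rmult_le_compat_r; [exact: norm_ge_0|lra].
have -> : eps = eps / 2 + eps / 2 by field.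
exact: Rplus_le_compat.
Qed.

End Completeness.

(* The equation [u' = G^-1 u] in the weak form [(G u)' = u], which makes sense
   for continuous [u]. *)
Definition weak_solution {X : NormedModule R_AbsRing} (G : X -> X)
  (u : R -> X) : Prop :=
  forall t, is_derive (fun s => G (u s)) t (u t).

Section WeakSolutions.

Context {X : NormedModule R_AbsRing} {ip : X -> X -> R}.
Context (hip : inner_product ip).
Context {G : X -> X} (hG : is_linear G).
Context (hskew : forall x y, ip (G x) y = - ip x (G y)).
Context (hinj : forall x, G x = zero -> x = zero).

Lemma skew_diag x : ip (G x) x = 0.
Proof. by have := hskew x x; rewrite (ip_sym ip hip x); lra. Qed.

Lemma weak_solution_plus u v :
  weak_solution G u -> weak_solution G v ->
  weak_solution G (fun t => plus (u t) (v t)).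
Proof.
move=> hu hv t; apply: is_derive_ext (is_derive_plus _ _ _ _ _ (hu t) (hv t)).
by move=> s; rewrite (linear_plus _ hG).
Qed.

Lemma weak_solution_linear (l : X -> X) u :
  is_linear l -> (forall x, l (G x) = G (l x)) -> weak_solution G u ->
  weak_solution G (fun t => l (u t)).
Proof.
move=> hl hlG hu t; apply: is_derive_ext (is_derive_linear l _ _ _ hl (hu t)).
by move=> s; rewrite hlG.
Qed.

Lemma weak_solution_minus u v :
  weak_solution G u -> weak_solution G v ->
  weak_solution G (fun t => minus (u t) (v t)).
Proof.
move=> hu hv; apply: weak_solution_plus => //.
by apply: weak_solution_linear => //; [exact: is_linear_opp|move=> x;
  rewrite linear_opp].
Qed.

Lemma weak_solution_shift h u :
  weak_solution G u -> weak_solution G (fun t => u (t + h)).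
Proof.
move=> hu t.
have hd : is_derive (fun s => s + h) t 1.
  have -> : 1 = plus 1 0 by rewrite /plus /=; ring.
  by apply: (is_derive_plus (fun s => s)); [apply: is_derive_id|apply: is_derive_const].
have := is_derive_comp _ _ _ _ _ (hu (t + h)) hd.
by rewrite scal_one.
Qed.

Lemma weak_solution_norm_G u :
  weak_solution G u -> forall t, norm (G (u t)) = norm (G (u 0)).
Proof.
move=> hu; apply: (norm_constant hip) hu _ => s.
by rewrite (ip_sym ip hip) skew_diag.
Qed.

Lemma weak_solution_unique u v :
  weak_solution G u -> weak_solution G v -> u 0 = v 0 -> forall t, u t = v t.
Proof.
move=> hu hv h0 t.
have := weak_solution_norm_G _ (weak_solution_minus _ _ hu hv) t.
rewrite h0 minus_eq_zero (linear_zero _ hG) norm_zero.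
move=> /norm_eq_zero /hinj h.
by apply: (plus_reg_r (opp (v t))); rewrite plus_opp_r.
Qed.

(** As [u] need not be differentiable, its norm is reached through difference quotients of [G u],
    taken at both times with one common step [h]. The roles of [t1] and [t2] are symmetric, so this
    inequality already contains equality. *)
Lemma weak_solution_norm_le u :
  weak_solution G u -> forall t1 t2, norm (u t1) <= norm (u t2).
Proof.
move=> hu t1 t2; apply: le_epsilon => eps he.
have he2 : 0 < eps / 2 by lra.
have [d1 H1] := proj1 (is_derive_eps _ _ _) (hu t1) _ he2.
have [d2 H2] := proj1 (is_derive_eps _ _ _) (hu t2) _ he2.
pose h := Rmin d1 d2 / 2.
have hm := Rmin_pos _ _ (cond_pos d1) (cond_pos d2).
have hm1 := Rmin_l d1 d2; have hm2 := Rmin_r d1 d2.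
have h0 : 0 < h by rewrite /h; lra.
have := H1 (t1 + h); have := H2 (t2 + h).
have -> : t1 + h - t1 = h by ring.
have -> : t2 + h - t2 = h by ring.
rewrite Rabs_right; last lra.
have hh1 : h < d1 by rewrite /h; lra.
have hh2 : h < d2 by rewrite /h; lra.
move=> /(_ hh2) K2 /(_ hh1) K1.
have E := weak_solution_norm_G _
  (weak_solution_minus _ _ (weak_solution_shift h _ hu) hu).
have E12 : norm (minus (G (u (t1 + h))) (G (u t1))) =
           norm (minus (G (u (t2 + h))) (G (u t2))).
  by rewrite -!(linear_minus _ _ _ hG) E -(E t2).
apply: (Rmult_le_reg_l h) => //.
rewrite -{1}(Rabs_right h); last lra.
rewrite -(norm_scal_R hip).
have -> : h * (norm (u t2) + eps) = eps / 2 * h + (eps / 2 * h + h * norm (u t2))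
  by field.
have -> : scal h (u t1) = plus (opp (minus (minus (G (u (t1 + h))) (G (u t1)))
  (scal h (u t1))))
   (minus (G (u (t1 + h))) (G (u t1))) by vec hip.
apply: norm_plus_le; first by rewrite norm_opp.
rewrite E12.
have -> : minus (G (u (t2 + h))) (G (u t2)) =
  plus (minus (minus (G (u (t2 + h))) (G (u t2))) (scal h (u t2)))
   (scal h (u t2)) by vec hip.
apply: norm_plus_le => //.
by rewrite (norm_scal_R hip) Rabs_right; lra.
Qed.

Lemma weak_solution_norm u :
  weak_solution G u -> forall t, norm (u t) = norm (u 0).
Proof. by move=> hu t; apply: Rle_antisym; apply: weak_solution_norm_le. Qed.

End WeakSolutions.

(** * The implicit Euler scheme *)

Section Resolvent.

Context {X : NormedModule R_AbsRing} {ip : X -> X -> R}.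
Context (hip : inner_product ip).
Context {G : X -> X} (hG : is_linear G).
Context (hskew : forall x y, ip (G x) y = - ip x (G y)).
Context (hinj : forall x, G x = zero -> x = zero).

(** A skew operator has no nonzero real eigenvalue: [G d = h d] gives [h |d|^2 = <G d, d> = 0]. The
    case [h = 0] is the injectivity of [G]. *)
Lemma shift_injective h x y :
  minus (G x) (scal h x) = minus (G y) (scal h y) -> x = y.
Proof.
move=> H; pose d : X := minus x y.
have Hd : G d = scal h d.
  rewrite /d (linear_minus _ _ _ hG).
  have -> : minus (G x) (G y) =
    plus (minus (G x) (scal h x)) (minus (scal h x) (G y)) by vec hip.
  by rewrite H; vec hip.
suff h0 : d = zero by apply: (plus_reg_r (opp y)); rewrite plus_opp_r.
case: (Req_dec h 0) => hh; first by apply: hinj; rewrite Hd hh scal_zero_l.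
have := skew_diag hip hskew d; rewrite Hd ip_scal // ip_norm // => E.
apply: norm_eq_zero; case: (Rmult_integral _ _ E) => // E2.
by apply: Rsqr_0_uniq; rewrite /Rsqr; move: E2; set n := norm _; lra.
Qed.

(* [res h = (G - h)^-1 G = (1 - h G^-1)^-1]; at [h = 0] this is the identity. *)
Context {res : R -> X -> X}.
Context (hres : forall h x, minus (G (res h x)) (scal h (res h x)) = G x).

(** The tool behind the algebra of [res]: a candidate value is verified after applying [G - h],
    which involves bounded operators only. *)
Lemma res_unique h x y : minus (G y) (scal h y) = G x -> res h x = y.
Proof. by move=> H; apply: (shift_injective h); rewrite hres H. Qed.

Lemma res_minus h x y : res h (minus x y) = minus (res h x) (res h y).
Proof.
apply: res_unique; rewrite !(linear_minus _ _ _ hG) -(hres h x) -(hres h y); vec hip.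
Qed.

Lemma res_plus h x y : res h (plus x y) = plus (res h x) (res h y).
Proof.
apply: res_unique; rewrite !(linear_plus _ hG) -(hres h x) -(hres h y); vec hip.
Qed.

Lemma res_scal h a x : res h (scal a x) = scal a (res h x).
Proof.
apply: res_unique; rewrite !(linear_scal _ hG) -(hres h x); vec hip.
Qed.

Lemma res_G h x : res h (G x) = G (res h x).
Proof.
by apply: res_unique; rewrite -(hres h x) (linear_minus _ _ _ hG) (linear_scal _ hG).
Qed.

(** With [r = res h x] the defining equation reads [G (r - x) = h r]. Skewness gives
    [h <r, r - x> = 0], hence [|r|^2 = <r, x>], whatever the sign of [h]. *)
Lemma res_contraction h x : norm (res h x) <= norm x.
Proof.
case: (Req_dec h 0) => hh.
  by right; congr norm; apply: res_unique; rewrite hh; vec hip.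
have E : G (minus (res h x) x) = scal h (res h x).
  by rewrite (linear_minus _ _ _ hG) -(hres h x); vec hip.
have := skew_diag hip hskew (minus (res h x) x); rewrite E.
rewrite /minus !(ipE hip) ip_norm // => E2.
have {}E2 : norm (res h x) ^ 2 = ip (res h x) x.
  have /Rmult_integral [//|] : h * (norm (res h x) ^ 2 - ip (res h x) x) = 0 by lra.
  lra.
have := cauchy_schwarz hip (res h x) x.
have := Rle_abs (ip (res h x) x); rewrite -E2 => h1 h2.
case: (Req_dec (norm (res h x)) 0) => [->|h3]; first exact: norm_ge_0.
have h4 : 0 < norm (res h x) by have := norm_ge_0 (res h x); lra.
by apply: (Rmult_le_reg_l (norm (res h x))) => //; lra.
Qed.

(** The first resolvent identity [R_a - R_b = (a - b) G^-1 R_a R_b], applied to [G x] so that the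
    unbounded factor cancels. *)
Lemma res_difference a b x :
  minus (res a (G x)) (res b (G x)) = scal (a - b) (res a (res b x)).
Proof.
apply: (shift_injective a).
rewrite (linear_minus _ _ _ hG) (linear_scal _ hG).
have E1 := hres a (G x); have E2 := hres a (res b x); have E3 := hres b (G x).
have -> : minus (minus (G (res a (G x))) (G (res b (G x))))
    (scal a (minus (res a (G x)) (res b (G x)))) =
  plus (minus (minus (G (res a (G x))) (scal a (res a (G x))))
    (minus (G (res b (G x))) (scal b (res b (G x)))))
    (scal (a - b) (res b (G x))) by vec hip.
rewrite E1 E3.
have -> : minus (scal (a - b) (G (res a (res b x))))
    (scal a (scal (a - b) (res a (res b x)))) =
  scal (a - b) (minus (G (res a (res b x))) (scal a (res a (res b x)))) by vec hip.
by rewrite E2 res_G; vec hip.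
Qed.

Let pow h n x := Nat.iter n (res h) x.

Lemma iter_res_G h n x : pow h n (G x) = G (pow h n x).
Proof. by elim: n => //= n IH; rewrite /pow /= -/(pow h n _) IH res_G. Qed.

Lemma iter_res_contraction h n x : norm (pow h n x) <= norm x.
Proof.
elim: n => [|n IH]; first exact: Rle_refl.
exact: Rle_trans (res_contraction _ _) IH.
Qed.

Lemma iter_res_minus h n x y :
  pow h n (minus x y) = minus (pow h n x) (pow h n y).
Proof. by elim: n => //= n IH; rewrite /pow /= -!/(pow h n _) IH res_minus. Qed.

(** One further implicit step moves a point of the range of [G] by [O(h)], because
    [R_h - 1 = h G^-1 R_h]. The bound does not deteriorate with [n]. *)
Lemma iter_res_succ h n x :
  norm (minus (pow h (S n) (G x)) (pow h n (G x))) <= Rabs h * norm x.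
Proof.
rewrite /pow Nat.iter_succ_r -!/(pow h n _) -iter_res_minus.
apply: Rle_trans (iter_res_contraction _ _ _) _.
have -> : minus (res h (G x)) (G x) = scal h (res h x).
  by rewrite res_G -(hres h x); vec hip.
rewrite (norm_scal_R hip); apply: Rmult_le_compat_l; first exact: Rabs_pos.
exact: res_contraction.
Qed.

Lemma res_lipschitz a b x :
  norm (minus (res a (G x)) (res b (G x))) <= Rabs (a - b) * norm x.
Proof.
rewrite res_difference (norm_scal_R hip).
apply: Rmult_le_compat_l; first exact: Rabs_pos.
exact: Rle_trans (res_contraction _ _) (res_contraction _ _).
Qed.

(** First-order expansion of [R_a^n] in the step [a] around [b], with derivative [n G^-1 R_b^(n+1)].
    The remainder involves [G^-1] twice, which is why the argument is [G (G x)]. *)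
Lemma iter_res_taylor n x : exists C, forall a b,
  norm (minus (minus (pow a n (G (G x))) (pow b n (G (G x))))
     (scal (a - b) (scal (INR n) (pow b (S n) (G x))))) <= C * (a - b) ^ 2.
Proof.
elim: n => [|n [C IH]].
  exists 0 => a b /=.
  have -> : minus (minus (pow a 0 (G (G x))) (pow b 0 (G (G x))))
    (scal (a - b) (scal 0 (pow b 1 (G x)))) = zero by rewrite /pow /=; vec hip.
  by rewrite norm_zero; lra.
(* The old remainder passes through the contraction [res a]. The new contribution comes from
   replacing [res a] by [res b] in the linear term, whose coefficient is [(n + 1) (a - b)]; this
   costs another factor [|a - b| |x|]. *)
exists (C + INR (S n) * norm x) => a b.
pose r a b : X := minus (minus (pow a n (G (G x))) (pow b n (G (G x))))
     (scal (a - b) (scal (INR n) (pow b (S n) (G x)))).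
have hr : norm (r a b) <= C * (a - b) ^ 2 := IH a b.
have E1 : minus (res a (pow b n (G (G x)))) (pow b (S n) (G (G x))) =
   scal (a - b) (res a (pow b (S n) (G x))).
  by rewrite /pow /= -!/(pow b n _) iter_res_G res_difference.
have E2 : pow a (S n) (G (G x)) = res a (plus (r a b) (plus (pow b n (G (G x)))
     (scal (a - b) (scal (INR n) (pow b (S n) (G x)))))).
  change (pow a (S n) (G (G x))) with (res a (pow a n (G (G x)))).
  by congr (res a _); rewrite /r; vec hip.
have E3 : minus (res a (G (pow b (S n) x))) (res b (G (pow b (S n) x))) =
  scal (a - b) (res a (pow b (S (S n)) x)).
  by rewrite res_difference.
have -> : minus (minus (pow a (S n) (G (G x))) (pow b (S n) (G (G x))))
     (scal (a - b) (scal (INR (S n)) (pow b (S (S n)) (G x)))) =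
  plus (res a (r a b)) (scal ((a - b) * INR (S n))
    (minus (res a (G (pow b (S n) x))) (res b (G (pow b (S n) x))))).
  rewrite E2 !res_plus !res_scal.
  rewrite -!iter_res_G.
  have -> : res b (pow b (S n) (G x)) = pow b (S (S n)) (G x) by [].
  have -> : res a (pow b n (G (G x))) = plus (pow b (S n) (G (G x)))
     (scal (a - b) (res a (pow b (S n) (G x)))) by rewrite -E1; vec hip.
  by rewrite S_INR; vec hip.
have -> : (C + INR (S n) * norm x) * (a - b) ^ 2 =
  C * (a - b) ^ 2 + INR (S n) * norm x * (a - b) ^ 2 by ring.
apply: norm_plus_le; first exact: Rle_trans (res_contraction _ _) hr.
rewrite (norm_scal_R hip) Rabs_mult (Rabs_right (INR _)); last exact/Rle_ge/pos_INR.
rewrite -(pow2_abs (a - b)).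
have hn := pos_INR (S n); have ha := Rabs_pos (a - b).
have -> : INR (S n) * norm x * Rabs (a - b) ^ 2 =
   Rabs (a - b) * INR (S n) * (Rabs (a - b) * norm x) by ring.
apply: Rmult_le_compat_l; first exact: Rmult_le_pos.
apply: Rle_trans (res_lipschitz _ _ _) _.
by apply: Rmult_le_compat_l => //; apply: iter_res_contraction.
Qed.

(** The exponent [n + 1] produced by differentiating the power cancels against the step length
    [s / (n + 1)]. *)
Lemma is_derive_euler n x t :
  is_derive (fun s => Nat.iter (S n) (res (s / INR (S n))) (G (G x))) t
    (Nat.iter (S (S n)) (res (t / INR (S n))) (G x)).
Proof.
have [C HC] := iter_res_taylor (S n) x.
have hn : INR (S n) <> 0 by apply: not_0_INR.
apply: (is_derive_quadratic _ _ (C / INR (S n) ^ 2)) => s.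
have -> : C / INR (S n) ^ 2 * (s - t) ^ 2 = C * (s / INR (S n) - t / INR (S n)) ^ 2.
  by field.
apply: Rle_trans _ (HC (s / INR (S n)) (t / INR (S n))); right; congr norm; congr minus.
have -> (y : X) : scal (s / INR (S n) - t / INR (S n)) (scal (INR (S n)) y) =
   scal ((s / INR (S n) - t / INR (S n)) * INR (S n)) y by vec hip.
have -> : (s / INR (S n) - t / INR (S n)) * INR (S n) = s - t by field.
by [].
Qed.

End Resolvent.

(** * Existence of the resolvents *)

Section Existence.

Context {X : CompleteNormedModule R_AbsRing} {ip : X -> X -> R}.
Context (hip : inner_product ip).
Context {G : X -> X} (hG : is_linear G).
Context (hskew : forall x y, ip (G x) y = - ip x (G y)).
Context (hinj : forall x, G x = zero -> x = zero).

(* The map [y |-> y - tau (h y - G y + z)] is a contraction: as G is skew,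
   [|(1 - tau h) x + tau G x|^2 = (1 - tau h)^2 |x|^2 + tau^2 |G x|^2]. *)
Lemma shift_surjective (h : R) (z : X) :
  h <> 0 -> exists y, minus (G y) (scal h y) = z.
Proof.
move=> hh; have [M [hM HM]] := linear_norm _ hG.
(* This [tau] minimizes [(1 - tau h)^2 + tau^2 M^2], and the minimum is [M^2 / D < 1], the square of
   the contraction constant. *)
pose D := h ^ 2 + M ^ 2; pose tau := h / D.
have hh2 : 0 < h ^ 2 by apply: pow2_gt_0.
have hD : 0 < D by rewrite /D; nra.
have [||y hy] := contraction_fixed_point
  (fun y => plus (scal (1 - tau * h) y) (scal tau (minus (G y) z))) (sqrt (M ^ 2 / D)).
- split; first exact: sqrt_pos.
  rewrite -[X in _ < X]sqrt_1; apply: sqrt_lt_1_alt; split.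
    by apply: Rdiv_le_0_compat => //; apply: pow2_ge_0.
  apply: (Rmult_lt_reg_r D) => //.
  by have -> : M ^ 2 / D * D = M ^ 2; [field; lra|rewrite /D; lra].
- move=> x y; apply: (norm_le_of_sq hip).
    by apply: Rmult_le_pos; [exact: sqrt_pos|exact: norm_ge_0].
  have [d hd] : exists d : X, d = minus x y by exists (minus x y).
  have -> : minus (plus (scal (1 - tau * h) x) (scal tau (minus (G x) z)))
      (plus (scal (1 - tau * h) y) (scal tau (minus (G y) z))) =
    plus (scal (1 - tau * h) d) (scal tau (G d)).
    by rewrite hd (linear_minus _ _ _ hG); vec hip.
  rewrite -hd !(ipE hip) (ip_sym ip hip d (G d)) (skew_diag hip hskew).
  rewrite !(ip_norm ip hip) Rpow_mult_distr pow2_sqrt; last first.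
    by apply: Rdiv_le_0_compat => //; apply: pow2_ge_0.
  have hGd : norm (G d) ^ 2 <= M ^ 2 * norm d ^ 2.
    rewrite -Rpow_mult_distr; apply: pow_incr; split; [exact: norm_ge_0|exact: HM].
  have ht : 0 <= tau ^ 2 by apply: pow2_ge_0.
  have E : M ^ 2 / D = (1 - tau * h) ^ 2 + tau ^ 2 * M ^ 2.
    by rewrite /tau /D; field; rewrite /D in hD; lra.
  rewrite E; nra.
exists y.
have ht : tau <> 0 by rewrite /tau;
  apply: Rmult_integral_contrapositive_currified => //; apply: Rinv_neq_0_compat; lra.
have E : scal tau (minus (minus (G y) (scal h y)) z) = zero.
  apply: (plus_reg_l y); rewrite plus_zero_r -{4}hy; vec hip.
have E2 : minus (minus (G y) (scal h y)) z = zero.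
  have -> : minus (minus (G y) (scal h y)) z =
    scal (/ tau) (scal tau (minus (minus (G y) (scal h y)) z)).
    by rewrite scal_assoc /mult /= Rinv_l // scal_one.
  by rewrite E scal_zero_r.
by apply: (plus_reg_r (opp z)); rewrite plus_opp_r.
Qed.

Lemma resolvent_exists : exists res : R -> X -> X,
  forall h x, minus (G (res h x)) (scal h (res h x)) = G x.
Proof.
have H h x : exists y, minus (G y) (scal h y) = G x.
  case: (Req_dec h 0) => hh; last exact: shift_surjective.
  by exists x; rewrite hh; vec hip.
exists (fun h x => proj1_sig (constructive_indefinite_description _ (H h x))) => h x.
exact: proj2_sig (constructive_indefinite_description _ (H h x)).
Qed.

End Existence.

(** * Convergence of the Euler scheme and existence for all initial values *)

Section WeakSolutionExistence.

Context {X : CompleteNormedModule R_AbsRing} {ip : X -> X -> R}.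
Context (hip : inner_product ip).
Context {G : X -> X} (hG : is_linear G).
Context (hskew : forall x y, ip (G x) y = - ip x (G y)).
Context (hinj : forall x, G x = zero -> x = zero).

Let solvable (x : X) := exists u : R -> X,
  u 0 = x /\ weak_solution G u /\ forall t, continuous u t.

(** Here [d n] is the derivative of the approximation [u n = G (p n)], and [d n - p n] is one Euler
    step, of size [O(1 / n)]. An exact solution would have [d n = p n]. *)
Lemma euler_converges (x : X) : solvable (G (G x)).
Proof.
have [res hres] := resolvent_exists hip hG hskew.
pose u n s : X := Nat.iter (S n) (res (s / INR (S n))) (G (G x)).
pose p n s : X := Nat.iter (S n) (res (s / INR (S n))) (G x).
pose d n s : X := Nat.iter (S (S n)) (res (s / INR (S n))) (G x).
have hn n : 0 < INR (S n) by apply: lt_0_INR; lia.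
have uE n s : u n s = G (p n s).
  by rewrite /u /p (iter_res_G hip hG hskew hinj hres).
have habs n s : Rabs (s / INR (S n)) = Rabs s / INR (S n).
  by rewrite /Rdiv Rabs_mult Rabs_inv (Rabs_right (INR _)) //; have := hn n; lra.
have hu n s : is_derive (u n) s (d n s).
  exact: (is_derive_euler hip hG hskew hinj hres).
have hdp n s : norm (minus (d n s) (p n s)) <= Rabs s / INR (S n) * norm x.
  by rewrite -habs; apply: (iter_res_succ hip hG hskew hinj hres).
have hd n s : norm (d n s) <= norm (G x).
  exact: (iter_res_contraction hip hG hskew hinj hres).
have hcauchy n m t : norm (minus (u n t) (u m t)) <=
    (Rabs t / INR (S n) + Rabs t / INR (S m)) * norm x * Rabs t.
  have h0 k : 0 <= Rabs t / INR (S k).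
    by apply: Rdiv_le_0_compat => //; apply: Rabs_pos.
  rewrite -[X in _ <= _ * Rabs X]Rminus_0_r.
  apply: (norm_growth hip (fun s => minus (u n s) (u m s)) (fun s => minus (d n s)
    (d m s))).
  - apply: Rmult_le_pos; last exact: norm_ge_0.
    by have := h0 n; have := h0 m; lra.
  - have E k : u k 0 = G (G x).
      rewrite /u /Rdiv Rmult_0_l; elim: (S k) => //= j ->.
      by apply: (res_unique hip hG hskew hinj hres); vec hip.
    by rewrite !E minus_eq_zero.
  - move=> s hs; split; first by apply: is_derive_minus.
    have hst : Rabs s <= Rabs t.
      by move: hs; rewrite /Rmin /Rmax; case: Rle_dec => h; split_Rabs; lra.
    (* The leading part [p n - p m] is orthogonal to [u n - u m = G (p n - p m)] by skewness, so
       only the consistency errors contribute to the growth of the difference. *)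
    have -> : minus (d n s) (d m s) = plus (minus (p n s) (p m s))
       (minus (minus (d n s) (p n s)) (minus (d m s) (p m s))) by vec hip.
    rewrite ip_plus // !uE -(linear_minus _ _ _ hG) (ip_sym ip hip _ (G _))
      (skew_diag hip hskew) Rplus_0_l.
    apply: Rle_trans (cauchy_schwarz hip _ _) _.
    apply: Rmult_le_compat_r; first exact: norm_ge_0.
    rewrite Rmult_plus_distr_r; apply: norm_plus_le; last rewrite norm_opp;
      apply: Rle_trans (hdp _ _) _; apply: Rmult_le_compat_r; try exact: norm_ge_0;
      apply: Rmult_le_compat_r => //; apply/Rlt_le/Rinv_0_lt_compat/hn.
have hlim t : exists l, forall eps, 0 < eps -> exists N, forall n, (N <= n)%nat ->
     norm (minus (u n t) l) <= eps.
  apply: cauchy_sequence_limit => eps he.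
  have [N HN] := inv_succ_lt (Rabs t * norm x * Rabs t) (eps / 2) ltac:(lra).
  exists N => n m hn1 hm1; apply: Rle_trans (hcauchy _ _ _) _.
  by have := HN n hn1; have := HN m hm1; rewrite /Rdiv; lra.
pose U t : X := proj1_sig (constructive_indefinite_description _ (hlim t)).
have hU t : forall eps, 0 < eps -> exists N, forall n, (N <= n)%nat ->
     norm (minus (u n t) (U t)) <= eps.
  exact: proj2_sig (constructive_indefinite_description _ (hlim t)).
have huU n t : norm (minus (u n t) (U t)) <= Rabs t * norm x * Rabs t / INR (S n).
  apply: le_epsilon => eps he.
  have [N1 H1] := hU t (eps / 2) ltac:(lra).
  have [N2 H2] := inv_succ_lt (Rabs t * norm x * Rabs t) (eps / 2) ltac:(lra).
  have h1 := H1 (N1 + N2)%nat ltac:(lia).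
  have h2 := H2 (N1 + N2)%nat ltac:(lia).
  apply: Rle_trans (norm_minus_triangle (u (N1 + N2)%nat t) _ _) _.
  apply: Rle_trans (Rplus_le_compat _ _ _ _ (hcauchy _ _ _) h1) _.
  by move: h2; rewrite /Rdiv; lra.
have hlipu n s t : norm (minus (u n s) (u n t)) <= norm (G x) * Rabs (s - t).
  apply: (norm_growth hip (fun s => minus (u n s) (u n t))
    (fun s => minus (d n s) zero)).
  - exact: norm_ge_0.
  - by rewrite minus_eq_zero.
  - move=> r _; split.
      by apply: is_derive_minus => //; apply: is_derive_const.
    rewrite minus_zero_r; apply: Rle_trans (cauchy_schwarz hip _ _) _.
    by apply: Rmult_le_compat_r => //; apply: norm_ge_0.
have hlip s t : norm (minus (U s) (U t)) <= norm (G x) * Rabs (s - t).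
  apply: le_epsilon => eps he.
  have [N1 H1] := hU s (eps / 2) ltac:(lra).
  have [N2 H2] := hU t (eps / 2) ltac:(lra).
  have h1 := H1 (N1 + N2)%nat ltac:(lia).
  have h2 := H2 (N1 + N2)%nat ltac:(lia).
  rewrite norm_minus_sym in h1.
  have -> : norm (G x) * Rabs (s - t) + eps =
    eps / 2 + (norm (G x) * Rabs (s - t) + eps / 2) by field.
  apply: Rle_trans (norm_minus_triangle (u (N1 + N2)%nat s) _ _) _.
  apply: Rplus_le_compat => //.
  apply: Rle_trans (norm_minus_triangle (u (N1 + N2)%nat t) _ _) _.
  exact: Rplus_le_compat.
have hlip2 t eps : 0 < eps -> exists delta : posreal, forall s, Rabs (s - t) < delta ->
    norm (minus (U s) (U t)) < eps.
  move=> he; have hc : 0 < norm (G x) + 1 by have := norm_ge_0 (G x); lra.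
  have hd0 : 0 < eps / (norm (G x) + 1) by apply: Rdiv_lt_0_compat.
  exists (mkposreal _ hd0) => s /= hs.
  apply: Rle_lt_trans (hlip _ _) _.
  apply: Rle_lt_trans (_ : (norm (G x) + 1) * Rabs (s - t) < _).
    by apply: Rmult_le_compat_r; [exact: Rabs_pos|lra].
  have -> : eps = (norm (G x) + 1) * (eps / (norm (G x) + 1)) by field; lra.
  exact: Rmult_lt_compat_l.
exists U; split.
  apply: (plus_reg_r (opp (G (G x)))); rewrite plus_opp_r.
  apply: norm_eq_zero; apply: Rle_antisym; last exact: norm_ge_0.
  rewrite -/(minus _ _) norm_minus_sym.
  have E : u 0%nat 0 = G (G x).
    rewrite /u /Rdiv Rmult_0_l /=.
    by apply: (res_unique hip hG hskew hinj hres); vec hip.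
  rewrite -E; apply: Rle_trans (huU _ _) _.
  by rewrite Rabs_R0 /Rdiv; lra.
split; last by move=> t; apply/continuous_eps => eps he; exact: hlip2.
move=> t.
apply: (is_derive_limit hip (fun n s => G (u n s)) (fun n s => G (d n s))
  (fun s => G (U s)) U).
- by move=> n s; apply: is_derive_linear.
- move=> s eps he; have [M [hM HM]] := linear_norm _ hG.
  have [N HN] := hU s (eps / M) ltac:(exact: Rdiv_lt_0_compat).
  exists N => n hn1; rewrite -(linear_minus _ _ _ hG).
  apply: Rle_trans (HM _) _.
  have -> : eps = M * (eps / M) by field; lra.
  by apply: Rmult_le_compat_l; [lra|apply: HN].
- move=> eps he.
  have [delta Hd] := hlip2 t (eps / 2) ltac:(lra).
  pose T := Rabs t + delta; have hT : 0 < T.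
    by rewrite /T; have := Rabs_pos t; have := cond_pos delta; lra.
  have [N HN] := inv_succ_lt (T * norm (G x) + T * norm x * T) (eps / 2) ltac:(lra).
  exists delta, N => n s hn1 hs.
  have hsT : Rabs s <= T.
    by rewrite /T; move: hs; split_Rabs; lra.
  have -> : minus (G (d n s)) (U t) = plus (minus (G (d n s)) (u n s))
    (plus (minus (u n s) (U s)) (minus (U s) (U t))) by vec hip.
  (* [G (d n s)] is [u n s] with one more resolvent applied. [T] bounds [|s|] on the whole
     neighbourhood, which makes the estimate uniform in [s]. *)
  have h1 : norm (minus (G (d n s)) (u n s)) <= T * norm (G x) / INR (S n).
    rewrite /d -(iter_res_G hip hG hskew hinj hres).
    apply: Rle_trans (iter_res_succ hip hG hskew hinj hres _ _ _) _.
    rewrite habs /Rdiv Rmult_assoc (Rmult_comm (/ _)) -Rmult_assoc.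
    apply: Rmult_le_compat_r; first exact/Rlt_le/Rinv_0_lt_compat/hn.
    by apply: Rmult_le_compat_r => //; apply: norm_ge_0.
  have h2 : norm (minus (u n s) (U s)) <= T * norm x * T / INR (S n).
    apply: Rle_trans (huU _ _) _.
    apply: Rmult_le_compat_r; first exact/Rlt_le/Rinv_0_lt_compat/hn.
    have := Rabs_pos s; have := norm_ge_0 x => ha hb.
    apply: Rmult_le_compat => //; first exact: Rmult_le_pos.
    exact: Rmult_le_compat_r.
  apply: Rle_trans (norm_plus_le _ _ _ _ h1 (norm_plus_le _ _ _ _ h2 (Rlt_le _ _ (Hd
    s hs)))) _.
  by have := HN n hn1; rewrite /Rdiv; lra.
Qed.

(** Weak solutions starting in the range of [G^2] approximate: the difference of two of them has
    constant norm, so convergence at time zero is convergence uniform in time, and this preserves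
    both continuity and the weak equation. *)
Theorem weak_solution_exists (x : X) :
  (forall y (eps : R), 0 < eps -> exists z, norm (minus (G z) y) < eps) ->
  exists u : R -> X, u 0 = x /\ weak_solution G u /\ forall t, continuous u t.
Proof.
move=> hdense.
have [M [hM HM]] := linear_norm _ hG.
have H n : exists u : R -> X, norm (minus (u 0) x) <= 1 / INR (S n) /\
    weak_solution G u /\ forall t, continuous u t.
  have hn : 0 < 1 / INR (S n) by apply: Rdiv_lt_0_compat; [lra|apply: lt_0_INR; lia].
  have [y hy] := hdense x (1 / INR (S n) / 2) ltac:(lra).
  (* Density of the range of [G^2]: the second approximation error is sent through [G] once more,
     hence the division by the bound [M] of [G]. *)
  have [z hz] := hdense y (1 / INR (S n) / 2 / M) ltac:(apply: Rdiv_lt_0_compat; lra).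
  have [u [u0 hu]] := euler_converges z.
  exists u; split => //; rewrite u0.
  apply: Rle_trans (norm_minus_triangle (G y) _ _) _.
  have -> : 1 / INR (S n) = M * (1 / INR (S n) / 2 / M) + 1 / INR (S n) / 2.
    by field; split; [apply: not_0_INR|lra].
  apply: Rplus_le_compat; last exact: Rlt_le.
  rewrite -(linear_minus _ _ _ hG); apply: Rle_trans (HM _) _.
  by apply: Rmult_le_compat_l; [lra|exact: Rlt_le].
pose u n : R -> X := proj1_sig (constructive_indefinite_description _ (H n)).
have hu n : norm (minus (u n 0) x) <= 1 / INR (S n) /\
    weak_solution G (u n) /\ forall t, continuous (u n) t.
  exact: proj2_sig (constructive_indefinite_description _ (H n)).
have hcauchy n m t : norm (minus (u n t) (u m t)) <= 1 / INR (S n) + 1 / INR (S m).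
  have [h1 [h2 _]] := hu n; have [h3 [h4 _]] := hu m.
  rewrite (weak_solution_norm hip hG hskew _ (weak_solution_minus hG _ _ h2 h4)).
  apply: Rle_trans (norm_minus_triangle x _ _) _.
  by rewrite (norm_minus_sym x); apply: Rplus_le_compat.
have hlim t : exists l, forall eps, 0 < eps -> exists N, forall n, (N <= n)%nat ->
     norm (minus (u n t) l) <= eps.
  apply: cauchy_sequence_limit => eps he.
  have [N HN] := inv_succ_lt 1 (eps / 2) ltac:(lra).
  exists N => n m hn1 hm1; apply: Rle_trans (hcauchy _ _ _) _.
  by have := HN n hn1; have := HN m hm1; lra.
pose U t : X := proj1_sig (constructive_indefinite_description _ (hlim t)).
have hU t : forall eps, 0 < eps -> exists N, forall n, (N <= n)%nat ->
     norm (minus (u n t) (U t)) <= eps.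
  exact: proj2_sig (constructive_indefinite_description _ (hlim t)).
have huU n t : norm (minus (u n t) (U t)) <= 1 / INR (S n).
  apply: le_epsilon => eps he.
  have [N1 H1] := hU t (eps / 2) ltac:(lra).
  have [N2 H2] := inv_succ_lt 1 (eps / 2) ltac:(lra).
  have h1 := H1 (N1 + N2)%nat ltac:(lia).
  have h2 := H2 (N1 + N2)%nat ltac:(lia).
  apply: Rle_trans (norm_minus_triangle (u (N1 + N2)%nat t) _ _) _.
  by apply: Rle_trans (Rplus_le_compat _ _ _ _ (hcauchy _ _ _) h1) _; lra.
(* The continuity of the single function [u N] supplies [delta] for every later [n], since the
   mutual distances are bounded uniformly in time. *)
have hunif eps t : 0 < eps -> exists (delta : posreal) (N : nat),
    forall n s, (N <= n)%nat -> Rabs (s - t) < delta -> norm (minus (u n s) (U t)) <=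
      eps.
  move=> he; have [N HN] := inv_succ_lt 1 (eps / 4) ltac:(lra).
  have [_ [_ hc]] := hu N.
  have [delta Hd] := proj1 (continuous_eps _ _) (hc t) (eps / 4) ltac:(lra).
  exists delta, N => n s hn hs.
  have -> : minus (u n s) (U t) = plus (minus (u n s) (u N s))
    (plus (minus (u N s) (u N t)) (minus (u N t) (U t))) by vec hip.
  apply: Rle_trans (norm_plus_le _ _ _ _ (hcauchy _ _ _)
    (norm_plus_le _ _ _ _ (Rlt_le _ _ (Hd s hs)) (huU _ _))) _.
  by have := HN n hn; have := HN N (le_n N); lra.
exists U; split; [|split].
- apply: (plus_reg_r (opp x)); rewrite plus_opp_r.
  apply: norm_eq_zero; apply: Rle_antisym; last exact: norm_ge_0.
  rewrite -/(minus _ _); apply: le_epsilon => eps he; rewrite Rplus_0_l.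
  have [N HN] := inv_succ_lt 1 (eps / 2) ltac:(lra).
  have [h1 _] := hu N; have h2 := huU N 0; rewrite norm_minus_sym in h2.
  apply: Rle_trans (norm_minus_triangle (u N 0) _ _) _.
  apply: Rle_trans (Rplus_le_compat _ _ _ _ h2 h1) _.
  by have := HN N (le_n N); lra.
- move=> t; apply: (is_derive_limit hip (fun n s => G (u n s)) u
    (fun s => G (U s)) U).
  + by move=> n s; have [_ [h _]] := hu n; apply: h.
  + move=> s eps he.
    have [N HN] := hU s (eps / M) ltac:(exact: Rdiv_lt_0_compat).
    exists N => n hn1; rewrite -(linear_minus _ _ _ hG).
    apply: Rle_trans (HM _) _.
    have -> : eps = M * (eps / M) by field; lra.
    by apply: Rmult_le_compat_l; [lra|apply: HN].
  + by move=> eps he; apply: hunif.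
- move=> t; apply/continuous_eps => eps he.
  have [delta [N Hd]] := hunif (eps / 4) t ltac:(lra).
  exists delta => s hs.
  have [N2 HN2] := inv_succ_lt 1 (eps / 4) ltac:(lra).
  pose n := (N + N2)%nat.
  have h1 := Hd n s ltac:(rewrite /n; lia) hs.
  have h2 := huU n s; rewrite norm_minus_sym in h2.
  have h3 := HN2 n ltac:(rewrite /n; lia).
  apply: Rle_lt_trans (norm_minus_triangle (u n s) _ _) _.
  by apply: Rle_lt_trans (Rplus_le_compat _ _ _ _ h2 h1) _; lra.
Qed.

End WeakSolutionExistence.

(** * Riemann-Stieltjes sums and spectral families *)

(** The data of a pointed subdivision of mesh below [delta], unpacked: each entry holds a right end
    and a tag, and the left end is the running parameter [a]. Statements about partitions thus
    become inductions on [l] with a moving left end. *)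
Fixpoint tagged_partition (delta a : R) (l : list (R * R)) : Prop :=
  match l with
  | nil => True
  | cons (x, xi) l' =>
      a <= xi <= x /\ x - a < delta /\ tagged_partition delta x l'
  end.

Fixpoint partition_sum {V : NormedModule R_AbsRing} (e : R -> R -> R -> V)
  (a : R) (l : list (R * R)) : V :=
  match l with
  | nil => zero
  | cons (x, xi) l' => plus (e a x xi) (partition_sum e x l')
  end.

Definition partition_end (a : R) (l : list (R * R)) : R := last a (unzip1 l).

Lemma Stieltjes_sum_partition {V : NormedModule R_AbsRing} (f : R -> R) (g
  : R -> V) a l :
  Stieltjes_sum f g (mkSF_seq a l) =
  partition_sum (fun x y xi => scal (f xi) (minus (g y) (g x))) a l.
Proof.
(* The dummy tag [0] paired with the initial point is generalized, because in the tail its place is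
   taken by the preceding tag. *)
rewrite /Stieltjes_sum /=; move: 0 => xi0.
elim: l a xi0 => [|[x xi] l IH] a xi0 //=.
by rewrite -(IH x xi).
Qed.

Section Partitions.

Context {V : NormedModule R_AbsRing}.

Lemma tagged_partition_of_subdiv (delta : R) (ptd : SF_seq) :
  pointed_subdiv ptd -> seq_step (SF_lx ptd) < delta ->
  tagged_partition delta (SF_h ptd) (SF_t ptd).
Proof.
case: ptd => a l /=; elim: l a => [|[x xi] l IH] a //= H.
rewrite /seq_step /= => hs.
have h0 := H O (Nat.lt_0_succ _); rewrite /= in h0.
split; [exact: h0|split].
- apply: Rle_lt_trans (Rle_abs _) _; apply: Rle_lt_trans hs; exact: Rmax_l.
- apply: IH; last by apply: Rle_lt_trans hs; exact: Rmax_r.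
  by move=> i hi; apply: (H (S i)); rewrite /SF_size /= in hi *; lia.
Qed.

Lemma partition_end_ge delta a l :
  tagged_partition delta a l -> a <= partition_end a l.
Proof.
elim: l a => [|[x xi] l IH] a /=; first by rewrite /partition_end /=; lra.
by move=> [h [_ /IH]]; rewrite /partition_end /=; lra.
Qed.

Lemma partition_sum_linear {W : NormedModule R_AbsRing} (l : V -> W) e a s :
  is_linear l ->
  l (partition_sum e a s) = partition_sum (fun x y xi => l (e x y xi)) a s.
Proof.
move=> hl; elim: s a => [|[x xi] s IH] a /=; first exact: linear_zero.
by rewrite linear_plus // IH.
Qed.

Lemma partition_sum_telescope (g : R -> V) a s :
  partition_sum (fun x y _ => minus (g y) (g x)) a s =
  minus (g (partition_end a s)) (g a).
Proof.
elim: s a => [|[x xi] s IH] a /=; first by rewrite minus_eq_zero.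
by rewrite IH plus_comm; symmetry; apply: minus_trans.
Qed.

Lemma partition_sum_minus (e e' : R -> R -> R -> V) a s :
  partition_sum (fun x y xi => minus (e x y xi) (e' x y xi)) a s =
  minus (partition_sum e a s) (partition_sum e' a s).
Proof.
elim: s a => [|[x xi] s IH] a /=; first by rewrite minus_eq_zero.
rewrite IH /minus opp_plus -!plus_assoc; congr plus.
by rewrite !plus_assoc; congr plus; rewrite plus_comm.
Qed.

Lemma is_RSInt_intro (f : R -> R) (g : R -> V) a b (I : V) :
  a <= b ->
  (forall eps, 0 < eps -> exists delta : posreal, forall l,
     tagged_partition delta a l -> partition_end a l = b ->
     norm (minus (partition_sum (fun x y xi => scal (f xi) (minus (g y) (g x))) a l) I)
       < eps) ->
  is_RSInt f g a b I.
Proof.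
move=> hab H; apply/filterlim_locally_ball_norm => eps.
have [delta Hd] := H eps (cond_pos eps).
exists delta => -[x l] hs [hp [/= ha hb]].
rewrite Rmin_left // in ha; rewrite Rmax_right // in hb; subst x.
rewrite /ball_norm Stieltjes_sum_partition; apply: Hd => //.
exact: (tagged_partition_of_subdiv _ _ hp).
Qed.

(** One partition, as fine and as wide as desired, serves two integrators at once. This is what
    allows a sum to be moved from one side of a scalar product to the other. *)
Lemma is_RSInt_line_elim2 (f : R -> R) (g1 g2 : R -> V) (I1 I2 : V) :
  is_RSInt_line f g1 I1 -> is_RSInt_line f g2 I2 ->
  forall eps delta M, 0 < eps -> 0 < delta -> exists a l,
    tagged_partition delta a l /\ a <= - M /\ M <= partition_end a l /\
    norm (minus (partition_sum (fun x y xi => scal (f xi) (minus (g1 y)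
      (g1 x))) a l) I1)
       < eps /\
    norm (minus (partition_sum (fun x y xi => scal (f xi) (minus (g2 y)
      (g2 x))) a l) I2)
       < eps.
Proof.
move=> H1 H2 eps delta M he hd.
have he2 : 0 < eps / 2 by lra.
have hloc (I : V) : locally I (fun y => norm (minus y I) < eps / 2).
  by apply: (locally_le_locally_norm I); exists (mkposreal _ he2) => y hy.
have K1 := H1 _ (hloc I1); have K2 := H2 _ (hloc I2).
rewrite /filtermapi in K1 K2.
have [Q1 Q2 [N1 hQ1] [N2 hQ2] HQ] := filter_and _ _ K1 K2.
(* Taking [M'] nonnegative guarantees [a <= b] below, also for negative [M]. *)
pose M' := Rmax 0 M.
have hM0 : 0 <= M' := Rmax_l _ _; have hMM : M <= M' := Rmax_r _ _.
pose a := Rmin (N1 - 1) (- M'); pose b := Rmax (N2 + 1) M'.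
have ha1 : a <= N1 - 1 := Rmin_l _ _; have ha2 : a <= - M' := Rmin_r _ _.
have hb1 : N2 + 1 <= b := Rmax_l _ _; have hb2 : M' <= b := Rmax_r _ _.
have [[y1 [/= i1 d1]] [y2 [/= i2 d2]]] := HQ a b (hQ1 a ltac:(lra)) (hQ2 b ltac:(lra)).
have hF : Filter (Riemann_fine a b) by apply: filter_filter.
have L1 := proj1 (filterlim_locally_ball_norm (FF := hF) _ _)
  i1 (mkposreal _ he2).
have L2 := proj1 (filterlim_locally_ball_norm (FF := hF) _ _)
  i2 (mkposreal _ he2).
have L3 : Riemann_fine a b (fun ptd => pointed_subdiv ptd /\ SF_h ptd = a /\
    last (SF_h ptd) (SF_lx ptd) = b /\ seq_step (SF_lx ptd) < delta).
  exists (mkposreal _ hd) => ptd hs [hp [h1 h2]]; split => //.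
  split; first by rewrite h1 Rmin_left //; lra.
  by split; [rewrite h2 Rmax_right //; lra|exact: hs].
have [[x l] [B1 [B2 [hp [/= hx [hl hs]]]]]] :=
  filter_ex _ (filter_and _ _ L1 (filter_and _ _ L2 L3)).
exists x, l; split; first exact: (tagged_partition_of_subdiv _ _ hp).
split; first lra.
split; first by rewrite /partition_end hl; lra.
move: B1 B2; rewrite /ball_norm !Stieltjes_sum_partition /= => B1 B2.
have -> : eps = eps / 2 + eps / 2 by field.
split.
- by apply: Rle_lt_trans (norm_minus_triangle y1 _ _) _; apply: Rplus_lt_compat.
- by apply: Rle_lt_trans (norm_minus_triangle y2 _ _) _; apply: Rplus_lt_compat.
Qed.

Lemma is_RSInt_line_linear {W : NormedModule R_AbsRing} (l : V -> W)
  (f : R -> R) (g : R -> V) (I : V) :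
  is_linear l -> is_RSInt_line f g I ->
  is_RSInt_line f (fun w => l (g w)) (l I).
Proof.
move=> hl H P HP.
have hc J : filterlim l (locally J) (locally (l J)) := linear_cont l J hl.
have := H _ (hc I _ HP); rewrite /filtermapi => K.
apply: filter_imp K => -[a b] /= [y [hy hPy]].
exists (l y); split => //.
have E ptd : Stieltjes_sum f (fun w => l (g w)) ptd = l (Stieltjes_sum f g ptd).
  case: ptd => x s; rewrite !Stieltjes_sum_partition partition_sum_linear //.
  elim: s x => [|[z xi] s IH] x //=.
  by rewrite IH (linear_scal l) // (linear_minus l).

apply: (filterlim_ext (fun ptd => l (Stieltjes_sum f g ptd))) => //.
exact: filterlim_comp hy (hc y).
Qed.

End Partitions.

(** * Integration against a spectral family *)

Section SpectralMeasure.

Context {X : NormedModule R_AbsRing} {ip : X -> X -> R}.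
Context (hip : inner_product ip).
Context {E : R -> X -> X} (hE : forall w, is_linear (E w)).
Context (hEsym : forall w x y, ip (E w x) y = ip x (E w y)).
Context (hEE : forall v w x, E v (E w x) = E (Rmin v w) x).

(** For [a <= b] and right-continuous [E], the spectral projection of the half-open interval
    [(a, b]]. *)
Definition spectral_increment a b x := minus (E b x) (E a x).

Let D := spectral_increment.

Lemma increment_linear a b : is_linear (D a b).
Proof.
apply: (is_linear_ext (fun x => plus (E b x) (opp (E a x)))) => //.
have h := is_linear_prod _ _ (hE b) (is_linear_comp _ _ (hE a) is_linear_opp).
exact: is_linear_comp _ _ h is_linear_plus.
Qed.

Lemma increment_sym a b x y : ip (D a b x) y = ip x (D a b y).
Proof. by rewrite /D /spectral_increment /minus !(ipE hip) !hEsym. Qed.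

Lemma increment_comp a b c d x : D a b (D c d x) =
  plus (minus (E (Rmin b d) x) (E (Rmin b c) x))
    (minus (E (Rmin a c) x) (E (Rmin a d) x)).
Proof.
rewrite /D /spectral_increment !(linear_minus _ _ _ (hE _)) !hEE; vec hip.
Qed.

Lemma increment_sub a b c d x : a <= c -> c <= d -> d <= b -> D a b (D c d x) = D c d x.
Proof.
move=> h1 h2 h3; rewrite increment_comp !(Rmin_right b) ?(Rmin_left a); try lra.
rewrite /D /spectral_increment; vec hip.
Qed.

Lemma increment_disjoint_l a b c d x
  : a <= b -> b <= c -> c <= d -> D a b (D c d x) = zero.
Proof. move=> h1 h2 h3; rewrite increment_comp !Rmin_left; try lra; vec hip. Qed.

Lemma increment_disjoint_r a b c d x
  : a <= b -> b <= c -> c <= d -> D c d (D a b x) = zero.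
Proof. move=> h1 h2 h3; rewrite increment_comp !Rmin_right; try lra; vec hip. Qed.

Lemma increment_norm a b x : a <= b -> norm (D a b x) <= norm x.
Proof.
move=> hab; apply: (projection_norm hip) => [y z|y]; first exact: increment_sym.
by apply: increment_sub => //; lra.
Qed.

(** Pythagoras on both sides: the terms lie in mutually orthogonal ranges, and so do the pieces of
    [z]. The bound is therefore independent of the number of pieces, which the triangle inequality
    would not give. *)
Lemma orthogonal_partition_sum (e : R -> R -> R -> X) (delta M : R) (z : X) a l :
  0 <= M ->
  (forall x y xi, x <= xi <= y -> y - x < delta ->
     D x y (e x y xi) = e x y xi /\ norm (e x y xi) <= M * norm (D x y z)) ->
  tagged_partition delta a l ->
  norm (partition_sum e a l) <= M * norm (D a (partition_end a l) z).
Proof.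
move=> hM He hl.
(* The induction must also carry that the sum lies in the range of its increment; this yields
   orthogonality to the next term. *)
suff [] : D a (partition_end a l) (partition_sum e a l) = partition_sum e a l /\
  norm (partition_sum e a l) <= M * norm (D a (partition_end a l) z) by [].
elim: l a hl => [|[x xi] l IH] a /=.
  move=> _; split; first exact: (linear_zero _ (increment_linear _ _)).
  by rewrite norm_zero; apply: Rmult_le_pos => //; apply: norm_ge_0.
move=> [hx [hd /[dup] hl /IH [IH1 IH2]]].
have hend := partition_end_ge _ _ _ hl.
have -> : partition_end a ((x, xi) :: l)%SEQ = partition_end x l by [].
have [h1 h2] := He a x xi hx hd.
move: IH1 IH2 h1 h2 hend.
move: (partition_sum e x l) (e a x xi) (partition_end x l) => r s b hr hrM hs hsM hb.
split.
  rewrite (linear_plus _ (increment_linear _ _)).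
  by rewrite -hs -hr !increment_sub //; lra.
apply: (norm_le_of_sq hip); first by apply: Rmult_le_pos => //; apply: norm_ge_0.
have horth : ip s r = 0.
  by rewrite -hs -hr increment_sym increment_disjoint_l ?(ipE hip) //; lra.
have hz : norm (D a b z) ^ 2 = norm (D a x z) ^ 2 + norm (D x b z) ^ 2.
  have -> : D a b z = plus (D a x z) (D x b z).
    by rewrite /D /spectral_increment; vec hip.
  have h0 : ip (D a x z) (D x b z) = 0.
    by rewrite increment_sym increment_disjoint_l ?(ipE hip) //; lra.
  move: (D a x z) (D x b z) h0 => u v h0.
  by rewrite -!(ip_norm ip hip) !(ipE hip) (ip_sym ip hip v) h0; ring.
rewrite !(ipE hip) (ip_sym ip hip r s) horth !(ip_norm ip hip).
rewrite Rpow_mult_distr hz Rmult_plus_distr_l -!Rpow_mult_distr.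
have := pow_incr _ _ 2 (conj (norm_ge_0 s) hsM).
have := pow_incr _ _ 2 (conj (norm_ge_0 r) hrM); lra.
Qed.

Context (hEm : forall x, filterlim (fun s => E s x) (Rbar_locally m_infty)
  (locally (zero : X))).
Context (hEp : forall x, filterlim (fun s => E s x) (Rbar_locally p_infty) (locally x)).

(* If [T] is close to [f xi] on each short spectral subspace around [xi], then
   [T] is the integral of [f] with respect to [E]: the errors on the pieces of a
   partition are mutually orthogonal. *)
Lemma spectral_integral (f : R -> R) (T : X -> X) (K : R) (z : X) :
  is_linear T -> (forall w x, T (E w x) = E w (T x)) ->
  (forall a b xi, a <= xi <= b ->
     norm (minus (scal (f xi) (D a b z)) (T (D a b z))) <=
       K * (b - a) * norm (D a b z)) ->
  is_RSInt_line f (fun w => E w z) (T z).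
Proof.
move=> hT hTE H.
have hTD a b x : T (D a b x) = D a b (T x).
  by rewrite /D /spectral_increment (linear_minus _ _ _ hT) !hTE.
pose K' := Rabs K + 1; have hK : K <= K' by rewrite /K'; have := Rle_abs K; lra.
have hK0 : 0 < K' by rewrite /K'; have := Rabs_pos K; lra.
have hab a b : a <= b -> is_RSInt f (fun w => E w z) a b (T (D a b z)).
  move=> hab; apply: is_RSInt_intro => // eps he.
  have hz : 0 < norm z + 1 by have := norm_ge_0 z; lra.
  have hd : 0 < eps / (K' * (norm z + 1)).
    by apply: Rdiv_lt_0_compat => //; apply: Rmult_lt_0_compat.
  exists (mkposreal _ hd) => l hl hb; rewrite /= in hl.
  set d := eps / _ in hd hl.
  have -> : T (D a b z) = partition_sum (fun x y _ => T (D x y z)) a l.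
    rewrite -(partition_sum_linear _ (fun x y _ => D x y z)) //.
    by rewrite /D /spectral_increment (partition_sum_telescope (fun w => E w z)) hb.
  rewrite -partition_sum_minus.
  have hs : norm (partition_sum (fun x y xi =>
      minus (scal (f xi) (minus (E y z) (E x z))) (T (D x y z))) a l) <=
      K' * d * norm (D a (partition_end a l) z).
    apply: (orthogonal_partition_sum _ d) => //.
      by apply: Rlt_le; apply: Rmult_lt_0_compat.
    move=> x y xi hxi hxy; rewrite -/(spectral_increment x y z) -/D; split.
      rewrite (linear_minus _ _ _ (increment_linear _ _))
        (linear_scal _ (increment_linear _ _)) -hTD.
      by rewrite increment_sub //; lra.
    apply: Rle_trans (H _ _ _ hxi) _.
    apply: Rmult_le_compat_r; first exact: norm_ge_0.
    by apply: Rle_trans (_ : K' * (y - x) <= _);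
      [apply: Rmult_le_compat_r|apply: Rmult_le_compat_l]; lra.
  apply: Rle_lt_trans hs _; rewrite hb.
  have hn := increment_norm a b z hab.
  apply: Rle_lt_trans (_ : K' * d * norm z < _).
    by apply: Rmult_le_compat_l => //; apply: Rlt_le; apply: Rmult_lt_0_compat.
  have -> : eps = K' * d * (norm z + 1).
    by rewrite /d; field; split; lra.
  by apply: Rmult_lt_compat_l; [apply: Rmult_lt_0_compat|lra].
have [M [hM HM]] := linear_norm _ hT.
move=> P /(locally_norm_le_locally (T z)) [eps Heps].
have he : 0 < eps / (2 * M) by apply: Rdiv_lt_0_compat; [exact: cond_pos|lra].
have [N1 H1] := proj1 (filterlim_locally_ball_norm _ _) (hEm z) (mkposreal _ he).
have [N2 H2] := proj1 (filterlim_locally_ball_norm _ _) (hEp z) (mkposreal _ he).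
(* Separating the ends by [0] ensures [a <= b]. It remains that [D a b z] tends to [z], since [T] is
   bounded. *)
apply: (Filter_prod _ _ _ (fun a => a < Rmin N1 0) (fun b => Rmax N2 0 < b)).
- by exists (Rmin N1 0).
- by exists (Rmax N2 0).
move=> a b ha hb /=.
have := Rmin_l N1 0; have := Rmin_r N1 0; have := Rmax_l N2 0; have := Rmax_r N2 0.
move=> q1 q2 q3 q4.
exists (T (D a b z)); split; first by apply: hab; lra.
apply: Heps; rewrite /ball_norm -(linear_minus _ _ _ hT).
apply: Rle_lt_trans (HM _) _.
have hb2 : norm (minus (E b z) z) < eps / (2 * M) := H2 b ltac:(lra).
have ha2 : norm (minus (E a z) zero) < eps / (2 * M) := H1 a ltac:(lra).
have -> : (eps : R) = M * (eps / (2 * M) + eps / (2 * M)) by field; lra.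
apply: Rmult_lt_compat_l => //.
have -> : minus (D a b z) z = plus (minus (E b z) z) (opp (minus (E a z) zero)).
  by rewrite /D /spectral_increment; vec hip.
by apply: norm_plus_lt => //; rewrite norm_opp.
Qed.

End SpectralMeasure.

(** * The spectral representation of the group *)

Section SpectralFlow.

Context {X : NormedModule R_AbsRing} {ip : X -> X -> R}.
Context (hip : inner_product ip).
Context {G : X -> X} (hG : is_linear G).
Context (hskew : forall x y, ip (G x) y = - ip x (G y)).
Context (hinj : forall x, G x = zero -> x = zero).
Context (hdense : forall (y : X) (eps
  : R), 0 < eps -> exists z, norm (minus (G z) y) < eps).

(* Multiplication by the imaginary unit. *)
Context {im : X -> X} (him : is_linear im).
Context (himskew : forall x y, ip (im x) y = - ip x (im y)).
Context (himim : forall x, im (im x) = opp x).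
Context (himG : forall x, im (G x) = G (im x)).

Context {E : R -> X -> X} (hE : forall w, is_linear (E w)).
Context (hEsym : forall w x y, ip (E w x) y = ip x (E w y)).
Context (hEE : forall v w x, E v (E w x) = E (Rmin v w) x).
Context (hEim : forall w x, E w (im x) = im (E w x)).
Context (hEm : forall x, filterlim (fun s => E s x) (Rbar_locally m_infty)
  (locally (zero : X))).
Context (hEp : forall x, filterlim (fun s => E s x) (Rbar_locally p_infty) (locally x)).

Let D : R -> R -> X -> X := spectral_increment (E := E).
Let D_linear a b : is_linear (D a b) := increment_linear hE a b.
Let K (x : X) : X := opp (im (G x)).

(* [K = - i G] is the inverse of the operator with spectral resolution [E]. *)
Context (hEK : forall x, is_RSInt_line (fun w => w) (fun w => E w (K x)) x).

Lemma im_norm x : norm (im x) = norm x.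
Proof.
rewrite !(norm_sqrt_ip hip); congr sqrt.
by rewrite himskew himim !(ipE hip); ring.
Qed.

Lemma K_linear : is_linear K.
Proof. exact: is_linear_comp _ _ (is_linear_comp _ _ hG him) is_linear_opp. Qed.

Lemma K_sym x y : ip (K x) y = ip x (K y).
Proof. by rewrite /K !(ipE hip) himskew hskew himG; ring. Qed.

Lemma K_dense (y : X) (eps : R) : 0 < eps -> exists z, norm (minus (K z) y) < eps.
Proof.
move=> he; have [z hz] := hdense (im y) eps he; exists z.
have -> : minus (K z) y = opp (im (minus (G z) (im y))).
  by rewrite (linear_minus _ _ _ him) himim /K; vec hip.
by rewrite norm_opp im_norm.
Qed.

(** A bounded, symmetric substitute for [H], commuting with [E]: over suitable partitions,
    [moment (K x)] tends to [x]. *)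
Let moment (x : X) a l : X :=
  partition_sum (fun y z xi => scal xi (minus (E z x) (E y x))) a l.

Lemma moment_sym x y a l : ip (moment x a l) y = ip x (moment y a l).
Proof.
rewrite /moment; elim: l a => [|[z xi] l IH] a /=; first by rewrite !(ipE hip).
rewrite (ip_plus ip hip) (ip_plus_r hip) IH; congr (_ + _).
by rewrite /minus !(ipE hip) !hEsym; ring.
Qed.

Lemma moment_spectral w x a l : E w (moment x a l) = moment (E w x) a l.
Proof.
rewrite /moment partition_sum_linear //; elim: l a => [|[z xi] l IH] a //=.
by rewrite IH (linear_scal _ (hE w)) (linear_minus _ _ _ (hE w)) !hEE !(Rmin_comm w).
Qed.

(** Replace [x] by a moment of [K x] and [y] by the moment of [K y] over the same partition: then
    both sides agree exactly, because moments are symmetric and commute with [E w]. The errors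
    vanish in the limit. *)
Lemma spectral_K_sym w x y : ip (E w x) (K y) = ip (K x) (E w y).
Proof.
have hE1 z : norm (E w z) <= norm z.
  apply: (projection_norm hip) => [u v|u] //; rewrite hEE Rmin_left //; lra.
have hC : 0 < norm (K x) + norm (K y) + 1.
  by have := norm_ge_0 (K x); have := norm_ge_0 (K y); lra.
apply: Rminus_diag_uniq; apply: cond_eq => eps he; rewrite Rminus_0_r.
have hd : 0 < eps / (norm (K x) + norm (K y) + 1) by apply: Rdiv_lt_0_compat.
have [a [l [_ [_ [_ [h1 h2]]]]]] :=
  is_RSInt_line_elim2 _ _ _ _ _ (hEK x) (hEK y) _ 1 0 hd Rlt_0_1.
rewrite -/(moment (K x) a l) in h1; rewrite -/(moment (K y) a l) in h2.
have E1 : ip (E w (moment (K x) a l)) (K y) = ip (K x) (E w (moment (K y) a l)).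
  by rewrite hEsym !moment_spectral moment_sym.
have -> : ip (E w x) (K y) - ip (K x) (E w y) =
  ip (K x) (E w (minus (moment (K y) a l) y)) - ip (E w (minus (moment (K x) a l) x))
    (K y).
  rewrite !(linear_minus _ _ _ (hE w)) (ip_minus_r hip) (ip_minus_l hip) E1; ring.
apply: Rle_lt_trans (Rabs_triang _ _) _; rewrite Rabs_Ropp.
set d := eps / _ in hd h1 h2.
have b1 := Rle_trans _ _ _ (cauchy_schwarz hip (K x) _) (Rmult_le_compat_l _ _ _
  (norm_ge_0 (K x)) (Rlt_le _ _ (Rle_lt_trans _ _ _ (hE1 _) h2))).
have b2 := Rle_trans _ _ _ (cauchy_schwarz hip _ (K y)) (Rmult_le_compat_r _ _ _
  (norm_ge_0 (K y)) (Rlt_le _ _ (Rle_lt_trans _ _ _ (hE1 _) h1))).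
apply: Rle_lt_trans (Rplus_le_compat _ _ _ _ b1 b2) _.
have -> : eps = (norm (K x) + norm (K y) + 1) * d by rewrite /d; field; lra.
lra.
Qed.

Lemma spectral_K w x : E w (K x) = K (E w x).
Proof.
apply: (ip_ext hip) => y.
by rewrite hEsym -spectral_K_sym -K_sym.
Qed.

Lemma spectral_G w x : E w (G x) = G (E w x).
Proof.
have h y : G y = im (K y).
  by rewrite /K linear_opp // himim opp_opp.
by rewrite !h hEim spectral_K.
Qed.

Lemma increment_K a b x : D a b (K x) = K (D a b x).
Proof. by rewrite /D /spectral_increment (linear_minus _ _ _ K_linear) !spectral_K. Qed.

(** With [y = D a b (K x)] this is [|H y - xi y| <= (b - a) |y|]. In the Riemann-Stieltjes sum for
    [H y - xi y] only the pieces meeting [(a, b]] survive, and their coefficients [w - xi] are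
    nearly bounded by [b - a]. *)
Lemma increment_approx a b xi x : a <= xi <= b ->
  norm (minus (D a b x) (scal xi (D a b (K x)))) <= (b - a) * norm (D a b (K x)).
Proof.
move=> hxi.
apply: le_epsilon => eps he.
pose y : X := D a b (K x).
have hy : 0 < norm y + 1 by have := norm_ge_0 y; lra.
pose d := eps / 2 / (norm y + 1).
have hd : 0 < d by apply: Rdiv_lt_0_compat; lra.
have [c [l [hl [hc [he' [h1 _]]]]]] := is_RSInt_line_elim2 _ _ _ _ _ (hEK x) (hEK x)
  (eps / 2) d (Rmax (- a) b) ltac:(lra) hd.
rewrite -/(moment (K x) c l) in h1.
have hca : c <= a by have := Rmax_l (- a) b; lra.
have hbe : b <= partition_end c l by have := Rmax_r (- a) b; lra.
have EDm : D a b (moment (K x) c l) = partition_sum (fun u v w => scal w (D u v y)) c l.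
  rewrite /D /spectral_increment !moment_spectral /moment -partition_sum_minus.
  elim: l c {hl hc he' h1 hca hbe} => [|[v w] l IH] c //=; rewrite IH; congr plus.
  rewrite /y /D /spectral_increment !(linear_minus _ _ _ (hE _)); vec hip.
have Ey : y = partition_sum (fun u v _ => D u v y) c l.
  rewrite /D /spectral_increment (partition_sum_telescope (fun w => E w y)).
  rewrite -/(spectral_increment (E := E) c (partition_end c l) y) /y /D.
  by rewrite (increment_sub hip hE hEE) //; lra.
have hsum : norm (minus (D a b (moment (K x) c l)) (scal xi y)) <=
    (b - a + d) * norm y.
  have -> : scal xi y = partition_sum (fun u v _ => scal xi (D u v y)) c l.
    rewrite {1}Ey (partition_sum_linear (scal xi)) //.
    by apply: is_linear_scal_r => p q; rewrite /mult /=; ring.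
  rewrite EDm -partition_sum_minus.
  apply: Rle_trans (orthogonal_partition_sum hip hE hEsym hEE _ d (b - a + d) y _ _ _
    _ hl) _.
  - lra.
  - move=> u v w huw hvu; rewrite -/D.
    have -> : minus (scal w (D u v y)) (scal xi (D u v y)) =
      scal (w - xi) (D u v y) by vec hip.
    split.
      rewrite (linear_scal _ (D_linear u v)); congr scal.
      by apply: (increment_sub hip hE hEE); lra.
    rewrite (norm_scal_R hip).
    case: (Rle_dec v a) => hva.
      have -> : D u v y = zero by apply: (increment_disjoint_l hip hE hEE); lra.
      by rewrite norm_zero; lra.
    case: (Rle_dec b u) => hub.
      have -> : D u v y = zero by apply: (increment_disjoint_r hip hE hEE); lra.
      by rewrite norm_zero; lra.
    apply: Rmult_le_compat_r; first exact: norm_ge_0.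
    (* A surviving piece has [u < b] and [a < v], so its tag leaves [[a, b]] by less than the mesh
       [d]. *)
    by split_Rabs; lra.
  - apply: Rmult_le_compat_l; first lra.
    apply: (increment_norm hip hE hEsym hEE).
    by have := partition_end_ge _ _ _ hl.
have -> : minus (D a b x) (scal xi (D a b (K x))) =
  plus (minus (D a b (moment (K x) c l)) (scal xi y))
    (opp (D a b (minus (moment (K x) c l) x))).
  by rewrite (linear_minus _ _ _ (D_linear a b)) /y; vec hip.
have hlast : (b - a + d) * norm y + eps / 2 <= (b - a) * norm (D a b (K x)) + eps.
  have hdy : d * norm y <= eps / 2.
    have -> : eps / 2 = d * (norm y + 1) by rewrite /d; field; lra.
    by apply: Rmult_le_compat_l; lra.
  by rewrite -/y; lra.
apply: Rle_trans hlast; apply: norm_plus_le => //; rewrite norm_opp.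
apply: Rle_trans (Rlt_le _ _ h1).
by apply: (increment_norm hip hE hEsym hEE); lra.
Qed.

Context {U : R -> X -> X} (hU0 : forall x, U 0 x = x).
Context (hU : forall x, weak_solution G (fun t => U t x)).

Lemma flow_norm t x : norm (U t x) = norm x.
Proof. by rewrite (weak_solution_norm hip hG hskew _ (hU x)) hU0. Qed.

(** Both sides are weak solutions with initial value [l x], so uniqueness identifies them. Linearity
    of the flow follows by the same device. *)
Lemma flow_commute (l : X -> X) t x : is_linear l ->
  (forall y, l (G y) = G (l y)) -> U t (l x) = l (U t x).
Proof.
move=> hl hlG; apply: (weak_solution_unique hip hG hskew hinj
  (fun t => U t (l x)) (fun t => l (U t x))) => //; last by rewrite !hU0.
exact: weak_solution_linear.
Qed.

Lemma flow_linear t : is_linear (U t).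
Proof.
split.
- move=> x y; apply: (weak_solution_unique hip hG hskew hinj
    (fun t => U t (plus x y)) (fun t => plus (U t x) (U t y))) => //;
      last by rewrite !hU0.
  exact: weak_solution_plus.
- move=> k x; apply: (flow_commute (scal k)) => [|y].
    by apply: is_linear_scal_r => p q; rewrite /mult /=; ring.
  by rewrite (linear_scal _ hG).
- by exists 1; split; [lra|move=> x; rewrite flow_norm; lra].
Qed.

(* [exp (- i theta) x] *)
Let rot (theta : R) (x : X) : X := minus (scal (cos theta) x) (scal (sin theta) (im x)).

Lemma rot_norm theta x : norm (rot theta x) <= 2 * norm x.
Proof.
have -> : 2 * norm x = 1 * norm x + 1 * norm x by ring.
have hc := COS_bound theta; have hs := SIN_bound theta.
apply: norm_plus_le; rewrite ?norm_opp (norm_scal_R hip) ?im_norm;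
  (apply: Rmult_le_compat_r; [exact: norm_ge_0|split_Rabs; lra]).
Qed.

(** On [p = K q] the flow is differentiable, with derivative [- i U s q]. The difference [phi] from
    the rotation satisfies [phi' = - i U s (q - xi p) - i xi phi]; the last term is orthogonal to
    [phi], and [increment_approx] bounds the first. *)
Lemma flow_K_approx t a b xi x : a <= xi <= b ->
  norm (minus (U t (D a b (K x))) (rot (xi * t) (D a b (K x)))) <=
  (b - a) * norm (D a b (K x)) * Rabs t.
Proof.
move=> hxi; rewrite -[X in _ <= _ * Rabs X]Rminus_0_r.
pose p : X := D a b (K x); pose q : X := D a b x; rewrite -/p.
have hp : p = K q by rewrite /p increment_K.
have hpq : norm (minus q (scal xi p)) <= (b - a) * norm p by apply: increment_approx.
have hUp s : U s p = K (U s q).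
  rewrite hp; apply: flow_commute; first exact: K_linear.
  move=> y; rewrite /K himG; symmetry; rewrite linear_opp //.
pose df s : X := minus (opp (im (U s q))) (opp (scal xi (im (rot (xi * s) p)))).
have Erot s : im (rot (xi * s) p) =
  plus (scal (cos (xi * s)) (im p)) (scal (sin (xi * s)) p).
  by rewrite /rot (linear_minus _ _ _ him) !(linear_scal _ him) himim; vec hip.
apply: (norm_growth hip (fun s => minus (U s p) (rot (xi * s) p)) df).
- by apply: Rmult_le_pos; [lra|exact: norm_ge_0].
- rewrite hU0 /rot Rmult_0_r cos_0 sin_0; vec hip.
- move=> s _; split.
    apply: is_derive_minus.
      apply: is_derive_ext (_ : is_derive (fun s => opp (im (G (U s q)))) s _).
        by move=> r; rewrite hUp.
      apply: is_derive_opp; apply: is_derive_linear him _; exact: hU.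
    have -> : opp (scal xi (im (rot (xi * s) p))) =
      minus (scal (xi * - sin (xi * s)) p) (scal (xi * cos (xi * s)) (im p)).
      by rewrite Erot; vec hip.
    have hlin : is_derive (fun s => xi * s) s xi.
      by apply/is_derive_Reals; have := derivable_pt_lim_scal id xi s 1
        (derivable_pt_lim_id s); rewrite Rmult_1_r.
    apply: is_derive_minus; apply: is_derive_scal_l.
      exact: (is_derive_comp cos) (is_derive_cos _) hlin.
    exact: (is_derive_comp sin) (is_derive_sin _) hlin.
  have -> : df s = minus (opp (im (U s (minus q (scal xi p)))))
      (scal xi (im (minus (U s p) (rot (xi * s) p)))).
    rewrite /df (linear_minus _ _ _ (flow_linear s)) (linear_scal _ (flow_linear s)).
    by rewrite !(linear_minus _ _ _ him) (linear_scal _ him); vec hip.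
  move: (minus (U s p) (rot (xi * s) p)) => phi.
  have h0 : ip (im phi) phi = 0 by apply: (skew_diag hip himskew).
  have -> : ip (minus (opp (im (U s (minus q (scal xi p))))) (scal xi (im phi))) phi =
    ip (opp (im (U s (minus q (scal xi p))))) phi.
    by rewrite (ip_minus_l hip) (ip_scal ip hip) // h0; ring.
  apply: Rle_trans (cauchy_schwarz hip _ _) _.
  apply: Rmult_le_compat_r; first exact: norm_ge_0.
  by rewrite norm_opp im_norm flow_norm.
Qed.

Lemma flow_approx t a b xi x : a <= xi <= b ->
  norm (minus (U t (D a b x)) (rot (xi * t) (D a b x))) <=
  Rabs t * (b - a) * norm (D a b x).
Proof.
move=> hxi; have hab : a <= b by lra.
apply: le_epsilon => eps he.
(* If [e] is the error of approximating by the range of [K], the rotation costs [2 |e|] (by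
   [rot_norm]), the isometric flow [|e|], and the bound for [K z] a further [|t| (b - a) |e|]. *)
have hC : 0 < Rabs t * (b - a) + 3.
  have : 0 <= Rabs t * (b - a) by apply: Rmult_le_pos; [exact: Rabs_pos|lra].
  lra.
have hd : 0 < eps / (Rabs t * (b - a) + 3) by apply: Rdiv_lt_0_compat.
have [z hz] := K_dense x _ hd.
pose e : X := D a b (minus (K z) x).
have Ee : D a b (K z) = plus (D a b x) e.
  by rewrite /e (linear_minus _ _ _ (D_linear a b)); vec hip.
have he' : norm e <= eps / (Rabs t * (b - a) + 3).
  by apply: Rle_trans (Rlt_le _ _ hz); apply: (increment_norm hip hE hEsym hEE).
have h1 := flow_K_approx t a b xi z hxi.
have -> : minus (U t (D a b x)) (rot (xi * t) (D a b x)) =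
  plus (minus (U t (D a b (K z))) (rot (xi * t) (D a b (K z))))
    (minus (rot (xi * t) e) (U t e)).
  have split u v : minus (U t u) (rot (xi * t) u) =
    plus (minus (U t (plus u v)) (rot (xi * t) (plus u v)))
      (minus (rot (xi * t) v) (U t v)).
    by rewrite (linear_plus _ (flow_linear t)) /rot (linear_plus _ him); vec hip.
  by rewrite Ee; apply: split.
have h2 : norm (minus (rot (xi * t) e) (U t e)) <= 2 * norm e + norm e.
  apply: norm_plus_le; first exact: rot_norm.
  by rewrite norm_opp flow_norm; exact: Rle_refl.
apply: Rle_trans (norm_plus_le _ _ _ _ h1 h2) _.
have h3 : norm (D a b (K z)) <= norm (D a b x) + norm e.
  by rewrite Ee; apply: norm_triangle.
have -> : eps = (Rabs t * (b - a) + 3) * (eps / (Rabs t * (b - a) + 3)) by field; lra.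
move: (eps / _) he' => d he'.
have hba : 0 <= Rabs t * (b - a) by apply: Rmult_le_pos; [exact: Rabs_pos|lra].
have := norm_ge_0 e.
move: (norm (D a b (K z))) (norm (D a b x)) (norm e) h3 he' => u v w h3 he' hw.
nra.
Qed.

Lemma flow_spectral t w x : U t (E w x) = E w (U t x).
Proof. by apply: flow_commute => // y; apply: spectral_G. Qed.

(** As [U t] is [exp (- i t H)], these two are [cos (t H)] and [sin (t H)]; the sign of the exponent
    explains the factor [i / 2] in the sine. *)
Definition flow_cos t x : X := scal (/ 2) (plus (U t x) (U (- t) x)).
Definition flow_sin t x : X := scal (/ 2) (im (minus (U t x) (U (- t) x))).

Lemma scal_linear (k : R) : is_linear (fun x : X => scal k x).
Proof. by apply: is_linear_scal_r => p q; rewrite /mult /=; ring. Qed.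

Lemma flow_cos_linear t : is_linear (flow_cos t).
Proof.
have h := is_linear_prod _ _ (flow_linear t) (flow_linear (- t)).
exact: is_linear_comp _ _ (is_linear_comp _ _ h is_linear_plus) (scal_linear _).
Qed.

Lemma flow_sin_linear t : is_linear (flow_sin t).
Proof.
have h := is_linear_prod _ _ (flow_linear t)
  (is_linear_comp _ _ (flow_linear (- t)) is_linear_opp).
exact: is_linear_comp _ _ (is_linear_comp _ _ (is_linear_comp _ _ h is_linear_plus)
  him) (scal_linear _).
Qed.

Lemma flow_cos_integral t x :
  is_RSInt_line (fun w => cos (w * t)) (fun w => E w x) (flow_cos t x).
Proof.
apply: (spectral_integral hip hE hEsym hEE hEm hEp _ _ (Rabs t)).
- exact: flow_cos_linear.
- by move=> w y; rewrite /flow_cos !flow_spectral (linear_scal _ (hE w))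
  (linear_plus _ (hE w)).
- move=> a b xi hxi; rewrite -/D.
  have h1 := flow_approx t a b xi x hxi.
  have h2 := flow_approx (- t) a b xi x hxi; rewrite Rabs_Ropp in h2.
  move: (D a b x) h1 h2 => y h1 h2.
  (* The approximations at times [t] and [- t] are averaged: the two rotations add up to
     [2 cos (xi t)]. *)
  have -> : minus (scal (cos (xi * t)) y) (flow_cos t y) =
    scal (- / 2) (plus (minus (U t y) (rot (xi * t) y)) (minus (U (- t) y)
      (rot (xi * - t) y))).
    rewrite /flow_cos /rot (_ : xi * - t = - (xi * t)); last by ring.
    by rewrite cos_neg sin_neg; vec hip; field.
  rewrite (norm_scal_R hip) Rabs_left; last lra.
  rewrite Ropp_involutive.
  have hhalf : 0 <= / 2 by lra.
  by apply: Rle_trans (Rmult_le_compat_l _ _ _ hhalf (norm_plus_le _ _ _ _ h1 h2)) _;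
    lra.
Qed.

Lemma flow_sin_integral t x :
  is_RSInt_line (fun w => sin (w * t)) (fun w => E w x) (flow_sin t x).
Proof.
apply: (spectral_integral hip hE hEsym hEE hEm hEp _ _ (Rabs t)).
- exact: flow_sin_linear.
- by move=> w y; rewrite /flow_sin !flow_spectral (linear_scal _ (hE w)) hEim
  (linear_minus _ _ _ (hE w)).
- move=> a b xi hxi; rewrite -/D.
  have h1 := flow_approx t a b xi x hxi.
  have h2 := flow_approx (- t) a b xi x hxi; rewrite Rabs_Ropp in h2.
  move: (D a b x) h1 h2 => y h1 h2.
  have -> : minus (scal (sin (xi * t)) y) (flow_sin t y) =
    scal (- / 2) (im (plus (minus (U t y) (rot (xi * t) y)) (opp (minus (U (- t) y)
      (rot (xi * - t) y))))).
    rewrite /flow_sin /rot (_ : xi * - t = - (xi * t)); last by ring.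
    rewrite cos_neg sin_neg (linear_plus _ him) (linear_opp _ _ him).
    by rewrite !(linear_minus _ _ _ him) !(linear_scal _ him) himim; vec hip; field.
  rewrite (norm_scal_R hip) Rabs_left; last lra.
  rewrite im_norm; rewrite -norm_opp in h2.
  rewrite Ropp_involutive.
  have hhalf : 0 <= / 2 by lra.
  by apply: Rle_trans (Rmult_le_compat_l _ _ _ hhalf (norm_plus_le _ _ _ _ h1 h2)) _;
    lra.
Qed.

End SpectralFlow.

(** * Reduction to a bounded skew operator *)

Section SelfadjointInverse.

Context {X : NormedModule R_AbsRing} {ip : X -> X -> R}.
Context (hip : inner_product ip).
Context {L : operator X} (hL : selfadjoint ip L).

Lemma selfadjoint_plus x y x' y' : L x y -> L x' y' -> L (plus x x') (plus y y').
Proof.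
move=> /(proj2 hL) h /(proj2 hL) h'; apply/(proj2 hL) => z w hzw.
by rewrite !(ipE hip) (h _ _ hzw) (h' _ _ hzw).
Qed.

Lemma selfadjoint_scal a x y : L x y -> L (scal a x) (scal a y).
Proof.
move=> /(proj2 hL) h; apply/(proj2 hL) => z w hzw.
by rewrite !(ipE hip) (h _ _ hzw).
Qed.

Lemma selfadjoint_minus x y x' y' : L x y -> L x' y' -> L (minus x x') (minus y y').
Proof.
move=> h h'; apply: selfadjoint_plus => //.
by rewrite -(scal_opp_one x') -(scal_opp_one y'); apply: selfadjoint_scal.
Qed.

(** The pair of [zero] and [y - y'] is in the graph of the adjoint, so [y - y'] is orthogonal to the
    dense domain. *)
Lemma selfadjoint_functional x y y' : L x y -> L x y' -> y = y'.
Proof.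
move=> h h'; have h0 := selfadjoint_minus _ _ _ _ h h'.
rewrite minus_eq_zero in h0; have h1 := proj1 (proj2 hL _ _) h0.
have horth z : op_dom L z -> ip z (minus y y') = 0.
  by move=> [w hw]; rewrite -(h1 _ _ hw) (ip_zero_r hip).
suff hz : minus y y' = zero by apply: (plus_reg_r (opp y')); rewrite plus_opp_r.
move: horth {h0 h1}; move: (minus y y') => d horth.
apply: norm_eq_zero; apply: Rle_antisym; last exact: norm_ge_0.
apply: le_epsilon => eps he; rewrite Rplus_0_l.
have [z [hz hzd]] := proj1 hL d (mkposreal eps he).
case: (Req_dec (norm d) 0) => [->|hd]; first by lra.
have hd0 : 0 < norm d by have := norm_ge_0 d; lra.
apply: (Rmult_le_reg_l (norm d)) => //.
have -> : norm d * norm d = - ip (minus z d) d.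
  by rewrite (ip_minus_l hip) horth // (ip_norm ip hip); ring.
apply: Rle_trans (Rle_abs _) _; rewrite Rabs_Ropp.
apply: Rle_trans (cauchy_schwarz hip _ _) _; rewrite Rmult_comm.
by apply: Rmult_le_compat_l; [exact: norm_ge_0|exact: Rlt_le].
Qed.

(* [L^2 = B] has a bounded inverse [T], so [L] is a bijection onto [X], and its
   inverse is bounded because [|L^-1 y|^2 = <y, T y>]. *)
Lemma selfadjoint_inverse (B : operator X) :
  (forall x y, B x y <-> op_comp L L x y) -> invertible B ->
  exists S : X -> X, is_linear S /\ (forall x y, ip (S x) y = ip x (S y)) /\
    forall x y, L x y <-> x = S y.
Proof.
move=> hB [T [hT hBT]].
have L0 : L zero zero by apply/(proj2 hL) => x w _; rewrite !(ipE hip).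
have hex y : exists x, L x y.
  have hTy : B (T y) y by apply/(hBT y (T y)).
  by have [z [_ hz]] := proj1 (hB _ _) hTy; exists z.
have hinj x x' y : L x y -> L x' y -> x = x'.
  move=> h h'; have h0 := selfadjoint_minus _ _ _ _ h h'.
  rewrite minus_eq_zero in h0.
  have hB0 : B (minus x x') zero by apply/hB; exists zero.
  have h1 : minus x x' = T zero by apply/hBT.
  rewrite (linear_zero _ hT) in h1.
  by apply: (plus_reg_r (opp x')); rewrite plus_opp_r.
pose S y := proj1_sig (constructive_indefinite_description _ (hex y)).
have hS y : L (S y) y := proj2_sig (constructive_indefinite_description _ (hex y)).
have hLS x y : L x y <-> x = S y by split=> [h|->] //; apply: hinj (hS y).
have hsym x y : ip (S x) y = ip x (S y).
  have := proj1 (proj2 hL _ _) (hS x) _ _ (hS y).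
  by rewrite (ip_sym ip hip y) (ip_sym ip hip (S y)).
exists S; split=> //; split.
- by move=> x y; symmetry; apply/hLS; apply: selfadjoint_plus.
- by move=> k x; symmetry; apply/hLS; apply: selfadjoint_scal.
- have [M [hM HM]] := linear_norm _ hT.
  exists (sqrt M); split; first exact: sqrt_lt_R0.
  move=> y; apply: (norm_le_of_sq hip).
    by apply: Rmult_le_pos; [exact: sqrt_pos|exact: norm_ge_0].
  have hSS : S (S y) = T y by apply/hBT/hB; exists (S y).
  rewrite hsym hSS Rpow_mult_distr pow2_sqrt; last lra.
  apply: Rle_trans (Rle_abs _) _; apply: Rle_trans (cauchy_schwarz hip _ _) _.
  apply: Rle_trans (Rmult_le_compat_l _ _ _ (norm_ge_0 y) (HM y)) _.
  by right; ring.
Qed.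

End SelfadjointInverse.

Section Reduction.

Context {X : CompleteNormedModule R_AbsRing} {ip : X -> X -> R}.
Context (hip : inner_product ip).
Context {B L : operator X} {J S : X -> X}.
Context (hBL : forall x y, B x y <-> op_comp L L x y).
Context (hJ : is_linear J).
Context (hJadj : forall x y, ip (J x) y = ip x (opp (J y))).
Context (hJ2 : forall x, J (J x) = opp x).
Context (hS : is_linear S) (hSsym : forall x y, ip (S x) y = ip x (S y)).
Context (hLS : forall x y, L x y <-> x = S y).
Context (hLfun : forall x y y', L x y -> L x y' -> y = y').
Context (hLdense : densely_defined L).

(* The inverse of [L J L]; the substitution [u = L x] turns the solutions [x]
   of the equation into the weak solutions [u] for [G]. *)
Definition reduced_inverse (x : X) : X := opp (S (J (S x))).

Let G := reduced_inverse.

Lemma S_injective x y : S x = S y -> x = y.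
Proof. by move=> h; apply: (hLfun (S x)); apply/hLS. Qed.

Lemma J_norm x : norm (J x) = norm x.
Proof.
rewrite !(norm_sqrt_ip hip); congr sqrt.
by rewrite hJadj hJ2 opp_opp.
Qed.

Lemma reduced_linear : is_linear G.
Proof.
exact: is_linear_comp _ _ (is_linear_comp _ _ (is_linear_comp _ _ hS hJ) hS)
  is_linear_opp.
Qed.

Lemma reduced_skew x y : ip (G x) y = - ip x (G y).
Proof.
rewrite /G /reduced_inverse (ip_opp_l hip)
  (ip_opp_r hip) hSsym hJadj (ip_opp_r hip) hSsym; ring.
Qed.

Lemma reduced_injective x : G x = zero -> x = zero.
Proof.
move=> h; apply: S_injective; rewrite (linear_zero _ hS).
have h1 : J (S x) = zero.
  apply: S_injective; rewrite (linear_zero _ hS).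
  by rewrite -(opp_opp (S (J (S x)))) -[opp (S _)]/(G x) h opp_zero.
by rewrite -(opp_opp (S x)) -(hJ2 (S x)) h1 (linear_zero _ hJ) opp_zero.
Qed.

Lemma S_dense (y : X) (eps : R) : 0 < eps -> exists z, norm (minus (S z) y) < eps.
Proof.
move=> he; have [x [[w /hLS ->] h]] := hLdense y (mkposreal eps he).
by exists w.
Qed.

(** If [S w] is near [y] and [S z] near [J w], then [G z = - S J S z] is near [- S J J w = S w]. *)
Lemma reduced_dense (y : X) (eps : R) : 0 < eps -> exists z, norm (minus (G z) y) < eps.
Proof.
move=> he; have [M [hM HM]] := linear_norm _ hS.
have [w hw] := S_dense y (eps / 2) ltac:(lra).
have [z hz] := S_dense (J w) (eps / 2 / M) ltac:(apply: Rdiv_lt_0_compat; lra).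
exists z.
have -> : minus (G z) y = plus (opp (S (J (minus (S z) (J w))))) (minus (S w) y).
  rewrite (linear_minus _ _ _ hJ) hJ2 (linear_minus _ _ _ hS) (linear_opp _ _ hS).
  by rewrite /G /reduced_inverse; vec hip.
have -> : eps = eps / 2 + eps / 2 by field.
apply: norm_plus_lt => //; rewrite norm_opp.
apply: Rle_lt_trans (HM _) _; rewrite J_norm.
have -> : eps / 2 = M * (eps / 2 / M) by field; lra.
exact: Rmult_lt_compat_l.
Qed.

Lemma op_inv_A z w :
  op_inv (op_comp (op_fun J) B) z w <-> w = opp (S (S (J z))).
Proof.
split.
- move=> [y [/hBL [v [/hLS -> /hLS ->]] ->]].
  by rewrite hJ2 !(linear_opp _ _ hS) opp_opp.
- move=> ->; exists (opp (J z)); split;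
  last by rewrite /op_fun linear_opp // hJ2 opp_opp.
  apply/hBL; exists (S (opp (J z))).
  by rewrite !hLS -!(linear_opp _ _ hS).
Qed.

(** [S (G u)] is a primitive of [S u], and [S G = A^-1 S], which is the integrated equation. *)
Lemma solution_of_weak (u : R -> X) :
  weak_solution G u -> (forall t, continuous u t) ->
  is_solution L (op_comp (op_fun J) B) (fun t => S (u t)).
Proof.
move=> hu hc; split; first split.
- by move=> t; exists (u t); apply/hLS.
- move=> t eps.
  have [delta Hd] := proj1 (continuous_eps _ _) (hc t) eps (cond_pos eps).
  exists delta => s hs; exists (minus (u s) (u t)); split; last exact: Hd s hs.
  by apply/hLS; rewrite (linear_minus _ _ _ hS).
- move=> t; exists (minus (S (G (u t))) (S (G (u 0)))); split.
    apply: (is_RInt_derive (fun t => S (G (u t)))) => s _.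
      by apply: is_derive_linear => //; apply: hu.
    by apply: continuous_comp (hc s) _; apply: linear_cont.
  apply/op_inv_A.
  rewrite (linear_minus _ _ _ hJ) !(linear_minus _ _ _ hS).
  by rewrite /G /reduced_inverse !(linear_opp _ _ hS); vec hip.
Qed.

(** Continuity of [x] in the norm [|L x|] makes [u = L x] continuous, hence integrable. The
    integrated equation is [S] applied to the identity between the integral of [u] and the increment
    of [G u]; injectivity removes this [S]. *)
Lemma weak_of_solution (x : R -> X) :
  is_solution L (op_comp (op_fun J) B) x ->
  exists u : R -> X, (forall t, x t = S (u t)) /\ weak_solution G u.
Proof.
move=> [[hdom hcont] hint].
pose u t : X := proj1_sig (constructive_indefinite_description _ (hdom t)).
have hxu t : x t = S (u t).
  by apply/hLS; apply: proj2_sig (constructive_indefinite_description _ (hdom t)).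
exists u; split => //.
have hc t : continuous u t.
  apply/continuous_eps => eps he.
  have [delta Hd] := hcont t (mkposreal eps he); exists delta => s hs.
  have [v [/hLS hv hn]] := Hd s hs.
  rewrite !hxu -(linear_minus _ _ _ hS) in hv.
  by rewrite (S_injective _ _ hv).
have hex t : ex_RInt u 0 t by apply: ex_RInt_continuous => s _; apply: hc.
pose F t : X := RInt u 0 t.
have hF t : is_derive F t (u t).
  apply: is_derive_RInt (hc t); apply: filter_forall => s.
  exact: RInt_correct.
have hFG t : F t = minus (G (u t)) (G (u 0)).
  have [I [hI /op_inv_A EI]] := hint t.
  have hSF : is_RInt x 0 t (minus (S (F t)) (S (F 0))).
    apply: (is_RInt_ext (fun s => S (u s))); first by move=> s _; rewrite hxu.
    apply: (is_RInt_derive (fun s => S (F s))) => s _.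
      by apply: is_derive_linear.
    by apply: continuous_comp (hc s) _; apply: linear_cont.
  have E : minus (S (F t)) (S (F 0)) = I.
    by rewrite -(is_RInt_unique _ _ _ _ hSF) -(is_RInt_unique _ _ _ _ hI).
  apply: S_injective.
  have F0 : F 0 = zero by apply: RInt_point.
  rewrite F0 (linear_zero _ hS) minus_zero_r in E.
  rewrite E EI !hxu (linear_minus _ _ _ hJ) !(linear_minus _ _ _ hS).
  by rewrite /G /reduced_inverse !(linear_opp _ _ hS); vec hip.
move=> t; have h := is_derive_plus _ _ _ _ _ (hF t) (is_derive_const (G (u 0)) t).
rewrite plus_zero_r in h; apply: is_derive_ext h => s.
by rewrite hFG; vec hip.
Qed.

End Reduction.

(** * The complexification as a real Hilbert space *)

Section Complexification.

Context {X : NormedModule R_AbsRing} {ip : X -> X -> R}.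
Context (hip : inner_product ip).

Definition cplx_re_ip (z w : cplx X) : R :=
  ip (fst z) (fst w) + ip (snd z) (snd w).

Definition cplx_map (f : X -> X) (z : cplx X) : cplx X := (f (fst z), f (snd z)).

Definition cplx_i (z : cplx X) : cplx X := (opp (snd z), fst z).

Lemma cplx_re_ip_inner_product : inner_product cplx_re_ip.
Proof.
split.
- by move=> x y; rewrite /cplx_re_ip (ip_sym ip hip) (ip_sym ip hip (snd x)).
- by move=> x y z; rewrite /cplx_re_ip /= !(ip_plus ip hip); ring.
- by move=> a x y; rewrite /cplx_re_ip /= !(ip_scal ip hip); ring.
- move=> x; rewrite /cplx_re_ip !(ip_norm ip hip).
  change (norm x) with (prod_norm x); rewrite /prod_norm pow2_sqrt //.
  by have := pow2_ge_0 (norm (fst x)); have := pow2_ge_0 (norm (snd x)); lra.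
Qed.

Lemma cplx_norm_le (z : cplx X) : norm z <= norm (fst z) + norm (snd z).
Proof.
have h1 := norm_ge_0 (fst z); have h2 := norm_ge_0 (snd z).
apply: (norm_le_of_sq cplx_re_ip_inner_product); first lra.
by rewrite /cplx_re_ip !(ip_norm ip hip); nra.
Qed.

Lemma cplx_map_linear f : is_linear f -> is_linear (cplx_map f).
Proof.
move=> hf; apply: (is_linear_prod (fun z => f (fst z)) (fun z => f (snd z))).
- exact: is_linear_comp _ _ is_linear_fst hf.
- exact: is_linear_comp _ _ is_linear_snd hf.
Qed.

Lemma cplx_i_linear : is_linear cplx_i.
Proof.
apply: (is_linear_prod (fun z : X * X => opp (snd z)) (fun z : X * X => fst z)).
- exact: is_linear_comp _ _ is_linear_snd is_linear_opp.
- exact: is_linear_fst.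
Qed.

Lemma cplx_i_scal z : cplx_scal Ci z = cplx_i z.
Proof.
rewrite /cplx_scal /cplx_i /=; congr pair; vec hip.
Qed.

Lemma cplx_real_scal (a : R) (z : cplx X) : cplx_scal (RtoC a) z = scal a z.
Proof. rewrite /cplx_scal; apply: injective_projections; rewrite /=; vec hip. Qed.

Lemma is_derive_cplx (f : R -> cplx X) t df :
  is_derive (fun s => fst (f s)) t (fst df) ->
  is_derive (fun s => snd (f s)) t (snd df) ->
  is_derive f t df.
Proof.
move=> /is_derive_eps H1 /is_derive_eps H2; apply/is_derive_eps => eps he.
have [d1 K1] := H1 (eps / 2) ltac:(lra); have [d2 K2] := H2 (eps / 2) ltac:(lra).
exists (mkposreal _ (Rmin_pos _ _ (cond_pos d1) (cond_pos d2))) => s /= hs.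
have h1 := K1 s (Rlt_le_trans _ _ _ hs (Rmin_l _ _)).
have h2 := K2 s (Rlt_le_trans _ _ _ hs (Rmin_r _ _)).
apply: Rle_trans (cplx_norm_le _) _.
by apply: Rle_trans (Rplus_le_compat _ _ _ _ h1 h2) _; lra.
Qed.

Section Projection.

Context {P : cplx X -> cplx X} (hP : orthogonal_projection ip P).

Lemma projection_zero : P zero = zero.
Proof.
have := proj_linear _ _ hP (RtoC 1) zero zero.
rewrite !cplx_real_scal !(scal_one (K := R_Ring)) plus_zero_l => h.
by apply: (plus_reg_l (P zero)); rewrite plus_zero_r -h.
Qed.

Lemma projection_scal c z : P (cplx_scal c z) = cplx_scal c (P z).
Proof.
have := proj_linear _ _ hP c z zero.
by rewrite projection_zero !plus_zero_r.
Qed.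

Lemma projection_sym z w : cplx_re_ip (P z) w = cplx_re_ip z (P w).
Proof. exact: (f_equal Re (proj_sym _ _ hP z w)). Qed.

Lemma projection_linear : is_linear P.
Proof.
split.
- move=> x y; have := proj_linear _ _ hP (RtoC 1) x y.
  by rewrite !cplx_real_scal !(scal_one (K := R_Ring)).
- by move=> k x; rewrite -!cplx_real_scal projection_scal.
- exists 1; split; first lra.
  move=> x; rewrite Rmult_1_l; apply: (projection_norm cplx_re_ip_inner_product).
    exact: projection_sym.
  exact: (proj_idem _ _ hP).
Qed.

End Projection.

End Complexification.

Section SpectralRepresentation.

Context {X : CompleteNormedModule R_AbsRing} {ip : X -> X -> R}.
Context (hip : inner_product ip).
Context {L : operator X} {J S : X -> X}.
Context (hJ : is_linear J).
Context (hJadj : forall x y, ip (J x) y = ip x (opp (J y))).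
Context (hJ2 : forall x, J (J x) = opp x).
Context (hS : is_linear S) (hSsym : forall x y, ip (S x) y = ip x (S y)).
Context (hLS : forall x y, L x y <-> x = S y).
Context (hLfun : forall x y y', L x y -> L x y' -> y = y').
Context (hLdense : densely_defined L).

Let G := reduced_inverse (J := J) (S := S).

(** [iJ] is its own inverse, so [H^-1 = S iJ S = - i G]. This puts every value of [- i G] into
    [D(H)], where the spectral integral is known to converge. *)
Lemma hamiltonian_inverse z :
  hamiltonian L J (opp (cplx_i (cplx_map G z))) z.
Proof.
exists (S (fst z), S (snd z)); split; last by split; apply/hLS.
exists (opp (J (S (snd z))), J (S (fst z))); split.
  split; apply/hLS; rewrite /= /G /reduced_inverse.
    by rewrite opp_opp (linear_opp _ _ hS).
  by rewrite opp_opp.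
rewrite /op_fun (cplx_i_scal hip) /cplx_i /=.
by rewrite (linear_opp _ _ hJ) !hJ2 !opp_opp.
Qed.

Lemma spectral_representation (E : R -> cplx X -> cplx X) (u : R -> X) :
  spectral_resolution ip (hamiltonian L J) E -> weak_solution G u ->
  forall t, exists I1 I2 : X,
    is_RSInt_line (fun w => cos (w * t)) (fun w => E_rr E w (u 0)) I1 /\
    is_RSInt_line (fun w => sin (w * t)) (fun w => E_ir E w (u 0)) I2 /\
    plus I1 I2 = u t.
Proof.
move=> hE hu t.
have hG : is_linear G := reduced_linear hJ hS.
have hskew := reduced_skew hip hJadj hSsym : forall x y, ip (G x) y = - ip x (G y).
have hinj := reduced_injective hJ hJ2 hS hLS hLfun : forall x, G x = zero -> x = zero.
have hdense := reduced_dense hip hJ hJadj hJ2 hS hLS hLdense :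
  forall (y : X) (eps : R), 0 < eps -> exists z, norm (minus (G z) y) < eps.
have hex x : exists v : R -> X, v 0 = x /\ weak_solution G v.
  have [v [h0 [hv _]]] := weak_solution_exists hip hG hskew hinj x hdense.
  by exists v.
pose V x : R -> X := proj1_sig (constructive_indefinite_description _ (hex x)).
have hV x : V x 0 = x /\ weak_solution G (V x) :=
  proj2_sig (constructive_indefinite_description _ (hex x)).
(* The solutions [V] are merely chosen; that they form a linear flow commuting with [im] comes from
   uniqueness. *)
pose U s (z : cplx X) : cplx X := (V (fst z) s, V (snd z) s).
have hU0 z : U 0 z = z.
  by case: z => a b; rewrite /U /=; congr pair; apply: (proj1 (hV _)).
have hU z : weak_solution (cplx_map G) (fun s => U s z).
  by move=> s; apply: (is_derive_cplx hip); apply: (proj2 (hV _)).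
have hcip := cplx_re_ip_inner_product hip.
have hGc := cplx_map_linear _ hG.
have hGcskew z w : cplx_re_ip (ip := ip) (cplx_map G z) w =
  - cplx_re_ip (ip := ip) z (cplx_map G w).
  by rewrite /cplx_re_ip /= !hskew; ring.
have hGcinj z : cplx_map G z = zero -> z = zero.
  by case: z => a b [/hinj -> /hinj ->].
have hGcdense (y : cplx X) (eps : R)
  : 0 < eps -> exists z, norm (minus (cplx_map G z) y) < eps.
  move=> he; have he2 : 0 < eps / 2 by lra.
  have [a ha] := hdense (fst y) _ he2; have [b hb] := hdense (snd y) _ he2.
  exists (a, b); apply: Rle_lt_trans (cplx_norm_le hip _) _.
  have -> : eps = eps / 2 + eps / 2 by field.
  exact: Rplus_lt_compat ha hb.
have hiskew z w : cplx_re_ip (ip := ip) (cplx_i z) w =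
  - cplx_re_ip (ip := ip) z (cplx_i w).
  by rewrite /cplx_re_ip /= !(ipE hip); ring.
have hii (z : cplx X) : cplx_i (cplx_i z) = opp z by [].
have hiG z : cplx_i (cplx_map G z) = cplx_map G (cplx_i z).
  by rewrite /cplx_i /cplx_map /= (linear_opp _ _ hG).
have hEl w := projection_linear hip (sr_proj _ _ _ hE w).
have hEsym w := projection_sym (sr_proj _ _ _ hE w).
have hEi w z : E w (cplx_i z) = cplx_i (E w z).
  by rewrite -!(cplx_i_scal hip) (projection_scal hip (sr_proj _ _ _ hE w)).
have hEK z := sr_val _ _ _ hE _ _ (hamiltonian_inverse z).
pose z0 : cplx X := (u 0, zero).
have hcos := flow_cos_integral hcip hGc hGcskew hGcinj hGcdense cplx_i_linear
  hiskew hii hiG hEl hEsym (sr_mono _ _ _ hE) hEi (sr_minfty _ _ _ hE)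
  (sr_pinfty _ _ _ hE) hEK hU0 hU t z0.
have hsin := flow_sin_integral hcip hGc hGcskew hGcinj hGcdense cplx_i_linear
  hiskew hii hiG hEl hEsym (sr_mono _ _ _ hE) hEi (sr_minfty _ _ _ hE)
  (sr_pinfty _ _ _ hE) hEK hU0 hU t z0.
(* These are the even and odd parts in [t] of the solution starting at [u 0]: the factor [i] has
   moved the odd part into the second component. *)
exists (fst (flow_cos (U := U) t z0)), (snd (flow_sin (im := cplx_i) (U := U) t z0)).
split; first exact: (is_RSInt_line_linear fst _ _ _ is_linear_fst hcos).
split; first exact: (is_RSInt_line_linear snd _ _ _ is_linear_snd hsin).
have -> : u t = V (u 0) t.
  by apply: (weak_solution_unique hip hG hskew hinj) => //; have [h0 h1] := hV (u 0).
rewrite /flow_cos /flow_sin /=; vec hip; field.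
Qed.

End SpectralRepresentation.
Theorem corollary2p5
  (X : CompleteNormedModule R_AbsRing) (ip : X -> X -> R)
  (hip : inner_product ip)
  (B : operator X) (hB : selfadjoint ip B) (hB0 : nonnegative ip B)
  (hBinv : invertible B)
  (J : X -> X) (hJ : is_linear J)
  (hJadj : forall x y, ip (J x) y = ip x (opp (J y)))
  (hJ2 : forall x, J (J x) = opp x)
  (L : operator X) (hL : is_sqrt ip L B) :
  let A := op_comp (op_fun J) B in
  (forall x0 : X, op_dom L x0 ->
     exists x : R -> X,
       is_solution L A x /\ x 0 = x0 /\
       (forall y : R -> X, is_solution L A y -> y 0 = x0 -> forall t, y t = x t) /\
       (exists h : R, forall t, energy L (x t) h))
  /\
  (forall E : R -> cplx X -> cplx X,
     spectral_resolution ip (hamiltonian L J) E ->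
     forall x : R -> X, is_solution L A x ->
     forall u0 : X, L (x 0) u0 ->
     forall t : R, exists I1 I2 : X,
       is_RSInt_line (fun w => cos (w * t)) (fun w => E_rr E w u0) I1 /\
       is_RSInt_line (fun w => sin (w * t)) (fun w => E_ir E w u0) I2 /\
       op_inv L (plus I1 I2) (x t)).
Proof.
move=> A.
have [hLsa [_ hBL]] := hL.
have [S [hS [hSsym hLS]]] := selfadjoint_inverse hip hLsa B hBL hBinv.
have hLfun := selfadjoint_functional hip hLsa.
have hLdense := proj1 hLsa.
have hG := reduced_linear hJ hS.
have hskew := reduced_skew hip hJadj hSsym.
have hinj := reduced_injective hJ hJ2 hS hLS hLfun.
split.
- move=> x0 [u0 /hLS ->].
  have [u [h0 [hu hc]]] := weak_solution_exists hip hG hskew hinj u0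
    (reduced_dense hip hJ hJadj hJ2 hS hLS hLdense).
  exists (fun t => S (u t)); split; last split; last split.
  + exact: (solution_of_weak hip hBL hJ hJ2 hS hLS).
  + by rewrite h0.
  + move=> y hy hy0 t.
    have [v [hyv hv]] := weak_of_solution hip hBL hJ hJ2 hS hLS hLfun y hy.
    rewrite hyv; congr S; apply: (weak_solution_unique hip hG hskew hinj) => //.
    by apply: (S_injective hLS hLfun); rewrite h0 -hyv.
  + exists (/ 2 * norm (u 0) ^ 2) => t; exists (u t); split; first by apply/hLS.
    by rewrite (weak_solution_norm hip hG hskew u hu).
- move=> E hE x hx u0 hu0 t.
  have [u [hxu hu]] := weak_of_solution hip hBL hJ hJ2 hS hLS hLfun x hx.
  (* [L] is single-valued, so the prescribed value [u0] of [L] at [x 0] is the initial value of the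
     weak solution. *)
  have -> : u0 = u 0 by apply: hLfun hu0 _; apply/hLS.
  have [I1 [I2 [h1 [h2 h3]]]] :=
    spectral_representation hip hJ hJadj hJ2 hS hSsym hLS hLfun hLdense E u hE hu t.
  exists I1, I2; split; [exact: h1|split; [exact: h2|]].
  by rewrite /op_inv h3; apply/hLS.
Qed.
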